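(* Let $(g,J)$ be a (left-)invariant almost Hermitian structure on the Lie group $S^3\times S^3$ such that $(S^3\times S^3,g,J)$ is strictly nearly Kähler. Then it is isomorphic, as a homogeneous almost Hermitian space, to the Ledger–Obata construction. In particular it is $3$-symmetric.
   Context: An almost Hermitian manifold $(M,g,J)$ is a Riemannian manifold with an almost complex structure $J$ such that $g(JX,JY)=g(X,Y)$ for all $X,Y$. It is nearly Kähler (NK) if $(\nabla_XJ)Y=-(\nabla_YJ)X$ for all $X,Y$ ($\nabla$ the Levi-Civita connection of $g$), and strictly nearly Kähler if moreover it is not Kähler. A $3$-symmetric space is a manifold $M$ with a family of global isometries $\theta_m$, $m\in M$, such that $m$ is an isolated fixed point of $\theta_m$ and $\theta_m^3=\mathrm{Id}$; its canonical almost complex structure $J$ is defined by $(\theta_m)_*=-\frac12\mathrm{Id}_{T_mM}+\frac{\sqrt3}{2}J_m$. Ledger–Obata construction: let $G$ be a compact Lie group with Lie algebra $\mathfrak g$ and a biinvariant metric $g$, and let $\Delta\simeq G$ be the diagonal subgroup of $G\times G\times G$. The homogeneous space $M=G\times G\times G/\Delta$ is identified with $G\times G$ by $[x,y,1]\mapsto(x,y)$. As $Ad(\Delta)$-invariant complement of the Lie algebra of $\Delta$ in $\mathfrak g\oplus\mathfrak g\oplus\mathfrak g$ one chooses the subspace $\mathfrak m$ of vectors whose component tangent to the first factor is zero, so that the restriction of $g\times g\times g$ to $\mathfrak m$ gives a metric on $M$ which is not the product metric of $G\times G$ but makes it naturally reductive. The circular permutation of $G\times G\times G$ is an automorphism of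 order $3$ which induces on $M$ a structure of $3$-symmetric space and, with the canonical almost complex structure, an NK structure. Here $G=SU(2)\simeq S^3$; joining two orthonormal bases of $\mathfrak g$ and extending by left invariance gives a (non-orthonormal) frame on $M$, in whose associated coframe $(e_1,e_2,e_3,f_1,f_2,f_3)$ the Kähler form is $\omega=\frac{\sqrt3}{2}(e_1\wedge f_1+e_2\wedge f_2+e_3\wedge f_3)$. The construction depends on the chosen biinvariant metric on $SU(2)$, but since $SU(2)$ is simple all of these are proportional.
   Formalization: The complement m in the Ledger–Obata construction is taken to be the vectors whose three components sum to zero, not those with zero first component: with the latter, the circular permutation is not an isometry and J is not orthogonal. *)

(* Defs.v *)
From HB Require Import structures.
From mathcomp Require Import all_boot all_order all_algebra.
From mathcomp Require Import all_classical all_reals all_analysis.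

Set Implicit Arguments.
Unset Strict Implicit.
Unset Printing Implicit Defensive.

Import Order.TTheory GRing.Theory Num.Theory.
Import numFieldNormedType.Exports.

Local Open Scope classical_set_scope.
Local Open Scope ring_scope.

(* Geometry on the unit quaternions S3 (= SU(2)) and on S3 x S3, embedded in
   H = R^4 and H x H.  Tensors and maps are functions of the ambient space whose
   values off the manifold are irrelevant. *)

Notation quat R := ('rV[R]_4).
Notation quat2 R := ('rV[R]_4 * 'rV[R]_4)%type.

Section Smooth.
Context {R : realType} {V W : normedModType R}.

Fixpoint ndifferentiable (k : nat) (f : V -> W) : Prop :=
  (forall x, differentiable f x) /\
  if k is k'.+1 then forall v, ndifferentiable k' (fun x => 'D_v f x) else True.

Definition smooth (f : V -> W) : Prop := forall k, ndifferentiable k f.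

(* For a closed submanifold M, smoothness on M is the existence of a smooth
   extension to the whole ambient space. *)
Definition smooth_on (M : set V) (f : V -> W) : Prop :=
  exists F : V -> W, smooth F /\ forall p, M p -> f p = F p.

End Smooth.

Section Metric.
Context {R : realType} {V : normedModType R}.

(* In this section M is a closed submanifold of V and T p its tangent space at
   p. *)

Definition vector_field (M : set V) (T : V -> set V) (X : V -> V) : Prop :=
  smooth_on M X /\ forall p, M p -> T p (X p).

Definition inner_product (E : set V) (b : V -> V -> R) : Prop :=
  [/\ forall u v, E u -> E v -> b u v = b v u,
      forall (c : R) u u' v, E u -> E u' -> E v ->
        b (c *: u + u') v = c * b u v + b u' v
    & forall u, E u -> u != 0 -> 0 < b u u].

Definition riemannian_metric (M : set V) (T : V -> set V)
    (g : V -> V -> V -> R) : Prop :=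
  (forall p, M p -> inner_product (T p) (g p)) /\
  (forall X Y, vector_field M T X -> vector_field M T Y ->
     smooth_on M (fun p => g p (X p) (Y p))).

End Metric.

Section Quaternions.
Context {R : realType}.
Implicit Types x y u v : quat R.

Definition qmk (a b c d : R) : quat R := \row_(i < 4) [:: a; b; c; d]`_i.

Definition qc x (k : nat) : R := x ord0 (inord k).

Definition q1 : quat R := qmk 1 0 0 0.

Definition qmul x y : quat R :=
  qmk (qc x 0 * qc y 0 - qc x 1 * qc y 1 - qc x 2 * qc y 2 - qc x 3 * qc y 3)
      (qc x 0 * qc y 1 + qc x 1 * qc y 0 + qc x 2 * qc y 3 - qc x 3 * qc y 2)
      (qc x 0 * qc y 2 - qc x 1 * qc y 3 + qc x 2 * qc y 0 + qc x 3 * qc y 1)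
      (qc x 0 * qc y 3 + qc x 1 * qc y 2 - qc x 2 * qc y 1 + qc x 3 * qc y 0).

(* The inverse on unit quaternions. *)
Definition qconj x : quat R := qmk (qc x 0) (- qc x 1) (- qc x 2) (- qc x 3).

Definition qdot x y : R := \sum_(i < 4) x ord0 i * y ord0 i.

(* The matrix norm of 'rV[R]_4 is the sup norm, hence this Euclidean one. *)
Definition qnorm x : R := Num.sqrt (qdot x x).

Definition S3 : set (quat R) := [set x | qdot x x = 1].

Definition tangent_S3 x : set (quat R) := [set u | qdot x u = 0].

(* Translations of S3 are restrictions of linear maps of H, so they act on
   tangent vectors by the same formula. *)
Definition biinvariant_metric (b : quat R -> quat R -> quat R -> R) : Prop :=
  riemannian_metric S3 tangent_S3 b /\
  forall a c x u v, S3 a -> S3 c -> S3 x -> tangent_S3 x u -> tangent_S3 x v ->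
    b (qmul (qmul a x) c) (qmul (qmul a u) c) (qmul (qmul a v) c) = b x u v.

End Quaternions.

Section S3xS3.
Context {R : realType}.
Notation H2 := (quat2 R).
Implicit Types (p q m u v : H2) (X Y Z : H2 -> H2).

Definition S3xS3 : set H2 := [set p | S3 p.1 /\ S3 p.2].

Definition tangent p : set H2 :=
  [set u | tangent_S3 p.1 u.1 /\ tangent_S3 p.2 u.2].

Definition mul2 p q : H2 := (qmul p.1 q.1, qmul p.2 q.2).

Definition inv2 p : H2 := (qconj p.1, qconj p.2).

Definition retraction p : H2 :=
  ((qnorm p.1)^-1 *: p.1, (qnorm p.2)^-1 *: p.2).

(* Differential at p, applied to u, of a map F defined on S3 x S3: for u tangent
   at p, the curve t |-> retraction (p + t u) lies on S3 x S3 and has velocity u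
   at t = 0. *)
Definition dM (W : normedModType R) (F : H2 -> W) p u : W :=
  'D_u (F \o retraction) p.

Notation field := (vector_field S3xS3 tangent).

Definition lie_bracket X Y p : H2 := dM Y p (X p) - dM X p (Y p).

Definition almost_hermitian (g : H2 -> H2 -> H2 -> R) (J : H2 -> H2 -> H2)
    : Prop :=
  [/\ riemannian_metric S3xS3 tangent g,
      forall p u, S3xS3 p -> tangent p u ->
        tangent p (J p u) /\ J p (J p u) = - u,
      forall p (c : R) u v, S3xS3 p -> tangent p u -> tangent p v ->
        J p (c *: u + v) = c *: J p u + J p v,
      forall X, field X -> field (fun p => J p (X p))
    & forall p u v, S3xS3 p -> tangent p u -> tangent p v ->
        g p (J p u) (J p v) = g p u v].

Definition levi_civita (g : H2 -> H2 -> H2 -> R)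
    (nabla : (H2 -> H2) -> (H2 -> H2) -> H2 -> H2) : Prop :=
  [/\ forall X Y, field X -> field Y -> field (nabla X Y),
      forall (f : H2 -> R) X X' Y, smooth_on S3xS3 f ->
        field X -> field X' -> field Y -> forall p, S3xS3 p ->
        nabla (fun q => f q *: X q + X' q) Y p
        = f p *: nabla X Y p + nabla X' Y p,
      forall (f : H2 -> R) X Y Y', smooth_on S3xS3 f ->
        field X -> field Y -> field Y' -> forall p, S3xS3 p ->
        nabla X (fun q => f q *: Y q + Y' q) p
        = dM f p (X p) *: Y p + f p *: nabla X Y p + nabla X Y' p,
      forall X Y, field X -> field Y -> forall p, S3xS3 p ->
        nabla X Y p - nabla Y X p = lie_bracket X Y p
    & forall X Y Z, field X -> field Y -> field Z -> forall p, S3xS3 p ->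
        dM (fun q => g q (X q) (Y q)) p (Z p)
        = g p (nabla Z X p) (Y p) + g p (X p) (nabla Z Y p)].

Definition nabla_J (nabla : (H2 -> H2) -> (H2 -> H2) -> H2 -> H2)
    (J : H2 -> H2 -> H2) X Y p : H2 :=
  nabla X (fun q => J q (Y q)) p - J p (nabla X Y p).

Definition nearly_kahler (nabla : (H2 -> H2) -> (H2 -> H2) -> H2 -> H2)
    (J : H2 -> H2 -> H2) : Prop :=
  forall X Y, field X -> field Y -> forall p, S3xS3 p ->
    nabla_J nabla J X Y p = - nabla_J nabla J Y X p.

Definition kahler (nabla : (H2 -> H2) -> (H2 -> H2) -> H2 -> H2)
    (J : H2 -> H2 -> H2) : Prop :=
  forall X Y, field X -> field Y -> forall p, S3xS3 p ->
    nabla_J nabla J X Y p = 0.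

Definition strictly_nearly_kahler
    (nabla : (H2 -> H2) -> (H2 -> H2) -> H2 -> H2) (J : H2 -> H2 -> H2)
    : Prop :=
  nearly_kahler nabla J /\ ~ kahler nabla J.

Definition diffeomorphism (F : H2 -> H2) : Prop :=
  [/\ smooth_on S3xS3 F,
      forall p, S3xS3 p -> S3xS3 (F p)
    & exists G : H2 -> H2,
        [/\ smooth_on S3xS3 G,
            forall p, S3xS3 p -> S3xS3 (G p)
          & forall p, S3xS3 p -> G (F p) = p /\ F (G p) = p]].

Definition preserves_metric (F : H2 -> H2) (g g' : H2 -> H2 -> H2 -> R)
    : Prop :=
  forall p u v, S3xS3 p -> tangent p u -> tangent p v ->
    g' (F p) (dM F p u) (dM F p v) = g p u v.

Definition preserves_acs (F : H2 -> H2) (J J' : H2 -> H2 -> H2) : Prop :=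
  forall p u, S3xS3 p -> tangent p u ->
    dM F p (J p u) = J' (F p) (dM F p u).

Definition left_invariant (g : H2 -> H2 -> H2 -> R) (J : H2 -> H2 -> H2)
    : Prop :=
  forall a, S3xS3 a ->
    preserves_metric (mul2 a) g g /\ preserves_acs (mul2 a) J J.

Definition lie_group_automorphism (phi : H2 -> H2) : Prop :=
  diffeomorphism phi /\
  forall p q, S3xS3 p -> S3xS3 q -> phi (mul2 p q) = mul2 (phi p) (phi q).

(* Isomorphism of almost Hermitian spaces homogeneous under the left
   translations of S3 x S3. *)
Definition homogeneous_isomorphic
    (g : H2 -> H2 -> H2 -> R) (J : H2 -> H2 -> H2)
    (g' : H2 -> H2 -> H2 -> R) (J' : H2 -> H2 -> H2) : Prop :=
  exists F phi : H2 -> H2,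
    [/\ diffeomorphism F,
        lie_group_automorphism phi,
        forall a p, S3xS3 a -> S3xS3 p -> F (mul2 a p) = mul2 (phi a) (F p),
        preserves_metric F g g'
      & preserves_acs F J J'].

(* theta m is the symmetry at m; J is required to be the canonical almost
   complex structure. *)
Definition three_symmetric (g : H2 -> H2 -> H2 -> R) (J : H2 -> H2 -> H2)
    : Prop :=
  exists theta : H2 -> H2 -> H2, forall m, S3xS3 m ->
    [/\ diffeomorphism (theta m) /\ preserves_metric (theta m) g g,
        theta m m = m,
        \forall p \near m, S3xS3 p -> theta m p = p -> p = m,
        forall p, S3xS3 p -> theta m (theta m (theta m p)) = p
      & forall u, tangent m u ->
          dM (theta m) m u = - 2^-1 *: u + (Num.sqrt 3 / 2) *: J m u].

(* The Ledger-Obata space G x G x G / Delta with G = S3, Delta acting on the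
   right.  [x, y, z] = [x z^-1, y z^-1, 1] corresponds to (x z^-1, y z^-1). *)
Definition lo_class (x y z : quat R) : H2 :=
  (qmul x (qconj z), qmul y (qconj z)).

(* Induced on the quotient by (x, y, z) |-> (z, x, y), from [p.1, p.2, 1]. *)
Definition lo_theta p : H2 := lo_class q1 p.1 p.2.

(* The symmetry at m, obtained by homogeneity. *)
Definition lo_symmetry m p : H2 := mul2 m (lo_theta (mul2 (inv2 m) p)).

(* Solves (lo_symmetry m)_* = -1/2 Id + sqrt 3 / 2 J_m for J_m. *)
Definition lo_J m u : H2 :=
  (2 / Num.sqrt 3) *: (dM (lo_symmetry m) m u + 2^-1 *: u).

(* The tangent space of the quotient at the base point is g + g + g modulo the
   diagonal.  The complement used is the Ad(Delta)-invariant subspace of the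
   (X, Y, Z) with X + Y + Z = 0, the only one of the form
   aX + bY + cZ = 0 that the circular permutation preserves; lo_lift is the
   representative in it of the class of (X, Y, 0). *)
Definition lo_lift (xi : H2) : quat R * quat R * quat R :=
  let s := 3^-1 *: (xi.1 + xi.2) in (xi.1 - s, xi.2 - s, - s).

(* The restriction of b x b x b to the complement, extended by left
   translations. *)
Definition lo_metric (b : quat R -> quat R -> quat R -> R) p u v : R :=
  let xi := lo_lift (mul2 (inv2 p) u) in
  let eta := lo_lift (mul2 (inv2 p) v) in
  b q1 xi.1.1 eta.1.1 + b q1 xi.1.2 eta.1.2 + b q1 xi.2 eta.2.

End S3xS3.

(* Main.v *)
(* Left invariance reduces everything to the Lie algebra R^3 + R^3.  There the
   Kaehler form is a + b + M, with a and b two-forms on the two factors and M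
   in R^3 (x) R^3, and its exterior derivative only involves M.  In the nearly
   Kaehler case d omega has type (3,0) + (0,3), so its contraction with
   omega^-1 vanishes; on this Lie algebra this says that a and b lie in the
   kernel of omega, whence a = b = 0 and M is invertible.  Compatibility of J
   with d omega then expresses the blocks of J through P = M M^T up to one
   scalar, which J^2 = -1 fixes by the Cayley-Hamilton theorem, and the
   proportionality of the Nijenhuis tensor to d omega is a quadratic equation
   for P that forces P to be scalar.  So M is a multiple of an orthogonal
   matrix; the automorphism of S3 x S3 it defines, followed by the exchange of
   the factors if det M < 0, carries (g, J) to the Ledger-Obata structure. *)

Require Import Defs.
From HB Require Import structures.
From mathcomp Require Import all_boot all_order all_algebra.
From mathcomp Require Import all_classical all_reals all_analysis.
From mathcomp Require Import ring lra.

Set Implicit Arguments.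
Unset Strict Implicit.
Unset Printing Implicit Defensive.

Import Order.TTheory GRing.Theory Num.Theory.
Import numFieldNormedType.Exports.

Local Open Scope classical_set_scope.
Local Open Scope ring_scope.

(** * Linear algebra in dimension three *)

(** The unknowns are J and omega rather than J and g, because d omega sees only M, and g is
    recovered as -J omega. The nearly Kaehler identity makes nabla omega totally skew, so d omega =
    3 nabla omega. Since nabla J anticommutes with J, J moves freely between the arguments of d
    omega, and the Nijenhuis tensor becomes four equal terms of nabla omega: hence the ratio 4/3. A
    contraction S of d omega is then anti-invariant under J while omega is invariant, so S omega^-1
    anticommutes with J and has trace 0. Once a = b = 0, vectors of the second factor are written z
    M^-T, dual to the first factor under omega. Most conditions on the blocks of J then become
    identities between endomorphisms of R^3. The sign of det M survives as a sign e in front of J;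
    exchanging the factors preserves the Ledger-Obata metric and reverses its J, which absorbs e.
    The isomorphisms obtained are restrictions of linear maps of H x H, hence their own
    differentials. *)

Definition i0 : 'I_3 := @Ordinal 3 0 isT.
Definition i1 : 'I_3 := @Ordinal 3 1 isT.
Definition i2 : 'I_3 := @Ordinal 3 2 isT.

Lemma ord3P (P : 'I_3 -> Prop) : P i0 -> P i1 -> P i2 -> forall i, P i.
Proof.
move=> p0 p1 p2 [[|[|[|//]]] lti3].
- by rewrite (_ : Ordinal _ = i0) //; apply/val_inj.
- by rewrite (_ : Ordinal _ = i1) //; apply/val_inj.
- by rewrite (_ : Ordinal _ = i2) //; apply/val_inj.
Qed.

Lemma sum_ord3 (V : nmodType) (F : 'I_3 -> V) :
  \sum_(i < 3) F i = F i0 + F i1 + F i2.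
Proof.
rewrite !big_ord_recl big_ord0 addr0 addrA.
by congr (F _ + F _ + F _); apply/val_inj.
Qed.

Section CrossProduct.
Variable R : comNzRingType.
Implicit Types (u v w x y z : 'rV[R]_3) (A B : 'M[R]_3).

Lemma mulmx3E m n (A : 'M[R]_(m, 3)) (B : 'M[R]_(3, n)) i j :
  (A *m B) i j = A i i0 * B i0 j + A i i1 * B i1 j + A i i2 * B i2 j.
Proof. by rewrite mxE sum_ord3. Qed.

Definition row3 (a b c : R) : 'rV[R]_3 := \row_(i < 3) [:: a; b; c]`_i.

Definition dot u v : R :=
  u ord0 i0 * v ord0 i0 + u ord0 i1 * v ord0 i1 + u ord0 i2 * v ord0 i2.

Definition cross u v : 'rV[R]_3 :=
  row3 (u ord0 i1 * v ord0 i2 - u ord0 i2 * v ord0 i1)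
       (u ord0 i2 * v ord0 i0 - u ord0 i0 * v ord0 i2)
       (u ord0 i0 * v ord0 i1 - u ord0 i1 * v ord0 i0).

Lemma row3E a b c :
  (row3 a b c ord0 i0 = a) * (row3 a b c ord0 i1 = b)
  * (row3 a b c ord0 i2 = c).
Proof. by rewrite !mxE. Qed.

Lemma row3P u v : u ord0 i0 = v ord0 i0 -> u ord0 i1 = v ord0 i1 ->
  u ord0 i2 = v ord0 i2 -> u = v.
Proof. by move=> h0 h1 h2; apply/rowP; apply: ord3P. Qed.

Lemma mxtrace3 A : \tr A = A i0 i0 + A i1 i1 + A i2 i2.
Proof. exact: sum_ord3. Qed.

Lemma det3 A : \det A =
  A i0 i0 * (A i1 i1 * A i2 i2 - A i1 i2 * A i2 i1)
  + A i0 i1 * (A i1 i2 * A i2 i0 - A i1 i0 * A i2 i2)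
  + A i0 i2 * (A i1 i0 * A i2 i1 - A i1 i1 * A i2 i0).
Proof.
rewrite (expand_det_row _ i0) sum_ord3 /cofactor.
do 3![rewrite (expand_det_row _ ord0) !big_ord_recl big_ord0 /cofactor
  !det_mx11].
pose F m n := A (inord m) (inord n).
have AE i j : A i j = F i j by rewrite /F !inord_val.
rewrite !mxE !AE /= /bump /= !addn0 !add0n ?addn1 /=; ring.
Qed.

Local Ltac by_entries :=
  first [apply/matrixP; apply: ord3P; apply: ord3P | apply: row3P | idtac];
  rewrite ?mxtrace3 ?det3 /dot /cross ?(row3E, mulmx3E, mxE) /=; ring.

Lemma cross_anti u v : cross u v = - cross v u.
Proof. by_entries. Qed.

Lemma crossvv u : cross u u = 0.
Proof. by_entries. Qed.

Lemma dotC u v : dot u v = dot v u.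
Proof. by_entries. Qed.

Lemma dot_crossC u v w : dot (cross u v) w = dot (cross v w) u.
Proof. by_entries. Qed.

Lemma dot_mulmx u v A : dot (u *m A) v = dot u (v *m A^T).
Proof. by_entries. Qed.

(** The cofactor identity, free of inverses. It later turns cross products of M^-T back into M, and
    makes rotations automorphisms of the quaternions. *)
Lemma cross_cofactor u v A :
  cross (u *m A) (v *m A) *m A^T = \det A *: cross u v.
Proof. by_entries. Qed.

(** The first-order term of [cross_cofactor] at 1 + h A. *)
Lemma cross_trace u v A :
  cross (u *m A) v + cross u (v *m A) = \tr A *: cross u v - cross u v *m A^T.
Proof. by_entries. Qed.

(** The sum of the principal 2 x 2 minors, the middle coefficient of the characteristic
    polynomial. *)
Definition sigma2 A : R := A i0 i0 * A i1 i1 - A i0 i1 * A i1 i0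
  + (A i0 i0 * A i2 i2 - A i0 i2 * A i2 i0)
  + (A i1 i1 * A i2 i2 - A i1 i2 * A i2 i1).

Lemma mxtrace_sqr A : \tr (A *m A) = \tr A ^+ 2 - sigma2 A *+ 2.
Proof. rewrite /sigma2; by_entries. Qed.

(** The polynomial in [A] is its adjugate, by Cayley-Hamilton, so no invertibility is involved. *)
Lemma cross_adjugate u v A : cross (u *m A) (v *m A) =
  cross u v *m (A *m A - \tr A *: A + (sigma2 A)%:M)^T.
Proof.
rewrite /sigma2.
apply: row3P; rewrite mxtrace3 /cross !(row3E, mulmx3E, mxE) /=; ring.
Qed.

Lemma Cayley_Hamilton3 A :
  A *m A *m A = \tr A *: (A *m A) - sigma2 A *: A + (\det A)%:M.
Proof.
rewrite /sigma2.
apply/matrixP; apply: ord3P; apply: ord3P;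
 rewrite mxtrace3 det3 /dot /cross !(row3E, mulmx3E, mxE) /= ; ring.
Qed.

End CrossProduct.

(** * Left-invariant Kaehler forms *)

Section LieAlgebra.
Variable R : realFieldType.
Implicit Types (u v w x y z a b : 'rV[R]_3) (A M : 'M[R]_3).

Definition cross_mx a : 'M[R]_3 :=
  \matrix_(i < 3, j < 3) cross a (delta_mx ord0 i) ord0 j.

Lemma cross_mxE a :
  (cross_mx a i0 i0 = 0) * (cross_mx a i0 i1 = a ord0 i2)
  * (cross_mx a i0 i2 = - a ord0 i1)
  * (cross_mx a i1 i0 = - a ord0 i2) * (cross_mx a i1 i1 = 0)
  * (cross_mx a i1 i2 = a ord0 i0)
  * (cross_mx a i2 i0 = a ord0 i1) * (cross_mx a i2 i1 = - a ord0 i0)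
  * (cross_mx a i2 i2 = 0).
Proof. by do !split; rewrite !mxE /= ?mxE /=; ring. Qed.

Lemma outerE n (u v : 'rV[R]_n) i j : (u^T *m v) i j = u ord0 i * v ord0 j.
Proof. by rewrite mxE big_ord1 mxE. Qed.

Local Ltac by_entries :=
  first [apply/matrixP; apply: ord3P; apply: ord3P | apply: row3P | idtac];
  rewrite ?mxtrace3 ?det3 /dot /cross ?(outerE, cross_mxE, row3E, mulmx3E,
    mxE) /=; ring.

Lemma mul_cross_mx a x : x *m cross_mx a = cross a x.
Proof. by_entries. Qed.

(* Vectors are rows: the form is [X *m kahler_mx a b M *m Y^T], and an
   endomorphism J acts by [X |-> X *m J]. *)
Definition kahler_mx a b M : 'M[R]_(3 + 3) :=
  block_mx (cross_mx a) M (- M^T) (cross_mx b).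

(** The cofactor matrix, as the transpose of the polynomial expression of the adjugate. *)
Definition cof_mx M : 'M[R]_3 := (M *m M - \tr M *: M + (sigma2 M)%:M)^T.

Lemma dotE u v : u *m v^T = (dot u v)%:M.
Proof. by apply/matrixP => i j; rewrite !ord1 mulmx3E !mxE /= mulr1n. Qed.

Lemma cross_mx_mul a b :
  cross_mx a *m cross_mx b = b^T *m a - (dot a b)%:M.
Proof. by_entries. Qed.

Lemma cross_mx0 : cross_mx 0 = 0.
Proof. by_entries. Qed.

Lemma cross_mx_tr a : (cross_mx a)^T = - cross_mx a.
Proof. by_entries. Qed.

Lemma cross_mx_self a : cross_mx a *m a^T = 0.
Proof.
apply: trmx_inj.
by rewrite trmx_mul trmxK cross_mx_tr mulmxN mul_cross_mx crossvv oppr0 trmx0.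
Qed.

Lemma cof_mx_tr M : cof_mx M^T = (cof_mx M)^T.
Proof.
rewrite /cof_mx mxtrace_tr /sigma2 -trmx_mul.
by apply/matrixP; apply: ord3P; apply: ord3P; rewrite !(mulmx3E, mxE) /=; ring.
Qed.

Lemma mul_cof_mx_tr M : M *m (cof_mx M)^T = (\det M)%:M.
Proof.
rewrite /cof_mx trmxK mulmxDr mulmxBr -scalemxAr mulmxA Cayley_Hamilton3.
rewrite mul_mx_scalar -[_ - _ + _%:M]addrA [_ + (_ + _%:M)]addrC addrK.
by rewrite addrAC addNr add0r.
Qed.

Lemma cof_mxE M :
  (cof_mx M i0 i0 = M i1 i1 * M i2 i2 - M i1 i2 * M i2 i1)
  * (cof_mx M i0 i1 = M i1 i2 * M i2 i0 - M i1 i0 * M i2 i2)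
  * (cof_mx M i0 i2 = M i1 i0 * M i2 i1 - M i1 i1 * M i2 i0)
  * (cof_mx M i1 i0 = M i2 i1 * M i0 i2 - M i2 i2 * M i0 i1)
  * (cof_mx M i1 i1 = M i2 i2 * M i0 i0 - M i2 i0 * M i0 i2)
  * (cof_mx M i1 i2 = M i2 i0 * M i0 i1 - M i2 i1 * M i0 i0)
  * (cof_mx M i2 i0 = M i0 i1 * M i1 i2 - M i0 i2 * M i1 i1)
  * (cof_mx M i2 i1 = M i0 i2 * M i1 i0 - M i0 i0 * M i1 i2)
  * (cof_mx M i2 i2 = M i0 i0 * M i1 i1 - M i0 i1 * M i1 i0).
Proof.
by do !split; rewrite /cof_mx mxE !(mulmx3E, mxtrace3, mxE) /sigma2 /=; ring.
Qed.

(** The cofactor identity with one argument fixed; it cancels the off-diagonal blocks in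
    [mul_pfaffian_adj]. *)
Lemma mul_cross_mx_cof a M : M *m cross_mx (a *m M) = cross_mx a *m cof_mx M.
Proof.
apply/matrixP; apply: ord3P; apply: ord3P.
all: by rewrite !(mulmx3E, cof_mxE, cross_mxE); ring.
Qed.

(* The Pfaffian analogue of the adjugate matrix, see [mul_pfaffian_adj]. *)
Definition pfaffian_adj a b M : 'M[R]_(3 + 3) :=
  let X := a^T *m b - cof_mx M in
  block_mx (cross_mx (b *m M^T)) X (- X^T) (cross_mx (a *m M)).

(** The scalar is, up to sign, the Pfaffian of the form. This gives the inverse of the Kaehler
    matrix with quadratic entries, so that traces against it can be computed. *)
Lemma mul_pfaffian_adj a b M :
  kahler_mx a b M *m pfaffian_adj a b M =
    (\det M - dot (a *m M) b)%:M.
Proof.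
rewrite /kahler_mx /pfaffian_adj mulmx_block scalar_mx_block.
have cofT : M^T *m cof_mx M = (\det M)%:M.
  by rewrite -[cof_mx M]trmxK -cof_mx_tr mul_cof_mx_tr det_tr.
have XT : (a^T *m b - cof_mx M)^T = b^T *m a - (cof_mx M)^T.
  by rewrite linearB /= trmx_mul trmxK.
rewrite XT; congr block_mx.
- rewrite cross_mx_mul mulmxN mulmxBr mul_cof_mx_tr trmx_mul trmxK mulmxA.
  by rewrite opprB addrC addrA subrK raddfB /= dot_mulmx.
- by rewrite mulmxBr mulmxA cross_mx_self mul0mx sub0r mul_cross_mx_cof addNr.
- rewrite mulmxN mulmxBr mulmxA cross_mx_self mul0mx sub0r opprK mulNmx.
  by rewrite mul_cross_mx_cof cof_mx_tr addNr.
- rewrite mulNmx mulmxBr cofT cross_mx_mul trmx_mul mulmxA opprB.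
  by rewrite addrA subrK raddfB /= [dot b _]dotC.
Qed.

(* Contractions of d omega, up to a factor, with (z, 0) and with (0, w). *)
Definition psi_mx1 M z : 'M[R]_(3 + 3) :=
  let N := cross_mx z *m M in block_mx 0 (- N) N^T (cross_mx (z *m M)).

Definition psi_mx2 M w : 'M[R]_(3 + 3) :=
  let N := M *m cross_mx w in block_mx (- cross_mx (w *m M^T)) N (- N^T) 0.

Lemma mxtrace_cross_mx a : \tr (cross_mx a) = 0.
Proof. by rewrite mxtrace3 !cross_mxE !addr0. Qed.

Lemma mxtrace_outer n (u v : 'rV[R]_n) : \tr (u^T *m v) = (v *m u^T) ord0 ord0.
Proof. by rewrite mxtrace_mulC /mxtrace big_ord1. Qed.

Lemma mxtrace_cross_mx_mul a b : \tr (cross_mx a *m cross_mx b) = - 2 * dot a b.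
Proof. rewrite cross_mx_mul; by_entries. Qed.

(** The cofactor part contributes det M times the trace of a skew matrix, hence nothing; only the
    rank one part remains. *)
Lemma mxtrace_cross_adj a b M z : \tr (cross_mx z *m M *m (a^T *m b - cof_mx
  M)^T)
   = dot z (cross a (b *m M^T)).
Proof.
rewrite linearB /= mulmxBr -!mulmxA mul_cof_mx_tr mul_mx_scalar linearB linearZ
  /=.
rewrite mxtrace_cross_mx mulr0 subr0 trmx_mul trmxK.
rewrite (_ : M *m _ = (b *m M^T)^T *m a); last by rewrite trmx_mul trmxK mulmxA.
rewrite mulmxA -[cross_mx z]trmxK -trmx_mul mxtrace_outer cross_mx_tr.
rewrite mulmxN linearN mulmxN mul_cross_mx dotE !mxE /= mulr1n.
set p := b *m _; by_entries.
Qed.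

Lemma mxtrace_psi_mx1 a b M z : \tr (psi_mx1 M z *m pfaffian_adj a b M) =
  2 * dot z (cross a (b *m M^T) - a *m M *m M^T).
Proof.
rewrite /psi_mx1 /pfaffian_adj mulmx_block mxtrace_block !mul0mx add0r.
rewrite mulNmx mulmxN opprK mxtraceD mxtrace_cross_mx_mul.
rewrite -[\tr (_^T *m _)]mxtrace_tr trmx_mul trmxK [\tr (_^T *m _)]mxtrace_mulC.
rewrite mxtrace_cross_adj dot_mulmx.
set p := cross _ _; set q := _ *m M^T.
rewrite /dot !mxE; ring.
Qed.

Lemma mxtrace_psi_mx2 a b M w : \tr (psi_mx2 M w *m pfaffian_adj a b M) =
  2 * dot w (b *m M^T *m M + cross b (a *m M)).
Proof.
rewrite /psi_mx2 /pfaffian_adj mulmx_block mxtrace_block mul0mx addr0.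
rewrite !mulNmx mulmxN mxtraceD 3!raddfN /= mxtrace_cross_mx_mul.
rewrite -[\tr (_^T *m _)]mxtrace_tr trmx_mul trmxK [\tr (_^T *m _)]mxtrace_mulC.
rewrite -[\tr (M *m _ *m _)]mxtrace_tr !trmx_mul trmxK cross_mx_tr mulNmx
  mulmxN.
rewrite raddfN /= [\tr (_ *m (_ *m _))]mxtrace_mulC.
have := mxtrace_cross_adj b a M^T w.
rewrite trmxK cof_mx_tr [(_ - _)^T]linearB /= trmx_mul !trmxK => ->.
rewrite dot_mulmx trmxK.
set p := cross _ _; set q := _ *m M.
rewrite /dot !mxE; ring.
Qed.

(** The two relations have opposite signs, so S W^-1 anticommutes with J; conjugating by J then
    shows that its trace equals its own opposite. *)
Lemma mxtrace_anticommute n (J W S : 'M[R]_n) :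
  W \in unitmx -> J *m J = - 1%:M -> W *m J^T = - (J *m W) ->
  J *m S = S *m J^T -> \tr (S *m invmx W) = 0.
Proof.
move=> Wu JJ WJ SJ; set H := S *m _.
have JH : J *m H = - (H *m J).
  rewrite /H mulmxA SJ -!mulmxA -mulmxN; congr (S *m _).
  by rewrite -[J^T](mulKmx Wu) WJ mulmxN mulNmx mulmxA mulmxK.
have : \tr (J *m (J *m H)) = - \tr (J *m (J *m H)).
  by rewrite {1}JH mulmxN raddfN /= mxtrace_mulC -mulmxA mxtrace_mulC -mulmxA.
rewrite mulmxA JJ mulNmx mul1mx raddfN /= => h; lra.
Qed.

Lemma dot_eq0 u : (forall v, dot v u = 0) -> u = 0.
Proof.
move=> u0; apply: row3P; rewrite [RHS]mxE.
- by have := u0 (row3 1 0 0); rewrite /dot !row3E; lra.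
- by have := u0 (row3 0 1 0); rewrite /dot !row3E; lra.
- by have := u0 (row3 0 0 1); rewrite /dot !row3E; lra.
Qed.

Lemma mul_kahler_mx a b M x y : row_mx x y *m kahler_mx a b M =
  row_mx (cross a x - y *m M^T) (x *m M + cross b y).
Proof. by rewrite /kahler_mx mul_row_block !mul_cross_mx mulmxN. Qed.

(* [S *m invmx W] anticommutes with J for every contraction S of d omega, so it
   has trace 0; by the explicit adjugate these traces are the pairings under W
   of (b M^T, a M) with all vectors. *)
Lemma kahler_mx_exact a b M J : let W := kahler_mx a b M in
  W \in unitmx -> J *m J = - 1%:M -> W *m J^T = - (J *m W) ->
  (forall z, J *m psi_mx1 M z = psi_mx1 M z *m J^T) ->
  (forall w, J *m psi_mx2 M w = psi_mx2 M w *m J^T) -> a = 0 /\ b = 0.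
Proof.
move=> W Wu JJ WJ J1 J2.
have E : pfaffian_adj a b M = (\det M - dot (a *m M) b) *: invmx W.
  by rewrite -[LHS](mulKmx Wu) mul_pfaffian_adj mul_mx_scalar.
have tr0 S : J *m S = S *m J^T -> \tr (S *m pfaffian_adj a b M) = 0.
  move=> JS; rewrite E -scalemxAr linearZ /= (mxtrace_anticommute Wu JJ WJ JS).
  by rewrite mulr0.
have ker0 u v : row_mx u v *m W = 0 -> u = 0 /\ v = 0.
  move=> uvW; apply: eq_row_mx; rewrite row_mx0.
  by rewrite -[LHS](mulmxK Wu) uvW mul0mx.
(* The two families of traces are the two halves of (b M^T, a M) W, and W has trivial kernel. *)
have [bM aM] : b *m M^T = 0 /\ a *m M = 0.
  apply: ker0; rewrite mul_kahler_mx -[RHS]row_mx0; congr row_mx.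
    apply: dot_eq0 => z; have := tr0 _ (J1 z).
    by rewrite mxtrace_psi_mx1; lra.
  apply: dot_eq0 => z; have := tr0 _ (J2 z).
  by rewrite mxtrace_psi_mx2; lra.
(* Since a M = 0 and a x a = 0, the vector (a, 0) is in the kernel of W; likewise (0, b) below. *)
have [a0 _] : a = 0 /\ (0 : 'rV[R]_3) = 0.
  apply: ker0; rewrite mul_kahler_mx aM crossvv mul0mx subrr add0r.
  by rewrite -(mul_cross_mx b 0) mul0mx row_mx0.
have [_ b0] : (0 : 'rV[R]_3) = 0 /\ b = 0.
  apply: ker0; rewrite mul_kahler_mx bM crossvv !mul0mx subr0 addr0.
  by rewrite -(mul_cross_mx a 0) mul0mx row_mx0.
by [].
Qed.
End LieAlgebra.

(** * Exterior derivative and Nijenhuis tensor on the Lie algebra *)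

Section Classification.
Variable R : realFieldType.
Implicit Types (u v w x y z a b : 'rV[R]_3) (A B C D M P : 'M[R]_3).
Implicit Types (X Y Z : 'rV[R]_(3 + 3)) (J W : 'M[R]_(3 + 3)).

(* Half the Lie bracket: the commutator of imaginary quaternions is twice the
   cross product. *)
Definition half_bracket X Y : 'rV[R]_(3 + 3) :=
  row_mx (cross (lsubmx X) (lsubmx Y)) (cross (rsubmx X) (rsubmx Y)).

Definition form n (B : 'M[R]_n) (X Y : 'rV[R]_n) : R :=
  (X *m B *m Y^T) ord0 ord0.

(** Half of d omega for the left-invariant form with matrix [W]. [nijenhuis] is halved in the same
    way, so the ratio between the two is unaffected. *)
Definition psi W X Y Z : R :=
  - (form W (half_bracket X Y) Z + form W (half_bracket Y Z) X
     + form W (half_bracket Z X) Y).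

Definition nijenhuis J X Y : 'rV[R]_(3 + 3) :=
  half_bracket (X *m J) (Y *m J) - half_bracket (X *m J) Y *m J
  - half_bracket X (Y *m J) *m J - half_bracket X Y.

Lemma form_row_mx x y x' y' (B : 'M[R]_(3 + 3)) :
  form B (row_mx x y) (row_mx x' y') =
  dot (lsubmx (row_mx x y *m B)) x' + dot (rsubmx (row_mx x y *m B)) y'.
Proof.
by rewrite /form -[_ *m B]hsubmxK tr_row_mx mul_row_col !dotE !mxE /= !mulr1n
  row_mxKl row_mxKr.
Qed.

Lemma dot0l u : dot 0 u = 0. Proof. by rewrite /dot !mxE; ring. Qed.
Lemma dot0r u : dot u 0 = 0. Proof. by rewrite /dot !mxE; ring. Qed.
Lemma dotDl u v w : dot (u + v) w = dot u w + dot v w.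
Proof. by rewrite /dot !mxE; ring. Qed.
Lemma dotNl u w : dot (- u) w = - dot u w.
Proof. by rewrite /dot !mxE; ring. Qed.
Lemma dotZl c u w : dot (c *: u) w = c * dot u w.
Proof. by rewrite /dot !mxE; ring. Qed.
Lemma dotDr u v w : dot w (u + v) = dot w u + dot w v.
Proof. by rewrite /dot !mxE; ring. Qed.
Lemma dotNr u w : dot w (- u) = - dot w u.
Proof. by rewrite /dot !mxE; ring. Qed.
Lemma dotZr c u w : dot w (c *: u) = c * dot w u.
Proof. by rewrite /dot !mxE; ring. Qed.
Lemma cross0l u : cross 0 u = 0.
Proof. by rewrite -mul_cross_mx; apply: row3P;
  rewrite !mulmx3E !cross_mxE !mxE; ring. Qed.
Lemma cross0r u : cross u 0 = 0.
Proof. by rewrite -mul_cross_mx mul0mx. Qed.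
Lemma crossDl u v w : cross (u + v) w = cross u w + cross v w.
Proof. by apply: row3P; rewrite /cross !(row3E, mxE); ring. Qed.
Lemma crossDr u v w : cross w (u + v) = cross w u + cross w v.
Proof. by apply: row3P; rewrite /cross !(row3E, mxE); ring. Qed.
Lemma crossNl u w : cross (- u) w = - cross u w.
Proof. by apply: row3P; rewrite /cross !(row3E, mxE); ring. Qed.
Lemma crossNr u w : cross w (- u) = - cross w u.
Proof. by apply: row3P; rewrite /cross !(row3E, mxE); ring. Qed.
Lemma crossZl c u w : cross (c *: u) w = c *: cross u w.
Proof. by apply: row3P; rewrite /cross !(row3E, mxE); ring. Qed.
Lemma crossZr c u w : cross w (c *: u) = c *: cross w u.
Proof. by apply: row3P; rewrite /cross !(row3E, mxE); ring. Qed.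

Lemma form_kahler a b M x y x' y' :
  form (kahler_mx a b M) (row_mx x y) (row_mx x' y') =
  dot a (cross x x') + dot b (cross y y') + dot (x *m M) y'
  - dot (x' *m M) y.
Proof.
rewrite form_row_mx mul_kahler_mx row_mxKl row_mxKr !dotDl dotNl.
have -> : dot (y *m M^T) x' = dot (x' *m M) y by rewrite dot_mulmx trmxK dotC.
have -> : dot (cross a x) x' = dot a (cross x x') by rewrite dot_crossC dotC.
have -> : dot (cross b y) y' = dot b (cross y y') by rewrite dot_crossC dotC.
ring.
Qed.

Lemma Jacobi u v w :
  cross (cross u v) w + cross (cross v w) u + cross (cross w u) v = 0.
Proof. by apply: row3P; rewrite /cross !(row3E, mxE); ring. Qed.

(* Only the mixed part [M] of the Kaehler form contributes to its exterior
   derivative: by the Jacobi identity the other two parts are closed. *)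
Lemma psiE a b M x y x' y' x'' y'' :
  psi (kahler_mx a b M) (row_mx x y) (row_mx x' y') (row_mx x'' y'') =
  - (dot (cross x x' *m M) y'' + dot (cross x' x'' *m M) y
     + dot (cross x'' x *m M) y')
  + (dot (x'' *m M) (cross y y') + dot (x *m M) (cross y' y'')
     + dot (x' *m M) (cross y'' y)).
Proof.
rewrite /psi /half_bracket !row_mxKl !row_mxKr !form_kahler.
have Ja : dot a (cross (cross x x') x'') + dot a (cross (cross x' x'') x)
   + dot a (cross (cross x'' x) x') = 0 by rewrite -!dotDr Jacobi dot0r.
have Jb : dot b (cross (cross y y') y'') + dot b (cross (cross y' y'') y)
   + dot b (cross (cross y'' y) y') = 0 by rewrite -!dotDr Jacobi dot0r.
by lra.
Qed.

Lemma form_psi_mx a b M z w X Y :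
  form (psi_mx1 M z + psi_mx2 M w) X Y =
  psi (kahler_mx a b M) (row_mx z w) X Y.
Proof.
rewrite -[X]hsubmxK -[Y]hsubmxK psiE form_row_mx.
set x := lsubmx X; set y := rsubmx X; set x' := lsubmx Y; set y' := rsubmx Y.
rewrite mulmxDr !mul_row_block add_row_mx row_mxKl row_mxKr !mulmxN !mulmx0
  !add0r !addr0.
have h1 : dot (y *m (cross_mx z *m M)^T) x' = - dot (cross x' z *m M) y.
  by rewrite [LHS]dot_mulmx trmxK mulmxA mul_cross_mx dotC cross_anti mulNmx
    dotNl.
have h2 : dot (x *m cross_mx (w *m M^T)) x' = dot (cross x x' *m M) w.
  by rewrite mul_cross_mx dot_crossC dot_mulmx.
have h3 : dot (y *m (M *m cross_mx w)^T) x' = - dot (x' *m M) (cross w y).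
  rewrite [LHS]dot_mulmx trmxK mulmxA mul_cross_mx dotC 2!dot_crossC dotC.
  by rewrite cross_anti dotNr.
have h4 : dot (x *m (M *m cross_mx w)) y' = dot (x *m M) (cross y' w).
  by rewrite mulmxA mul_cross_mx 2!dot_crossC dotC.
have h5 : dot (y *m cross_mx (z *m M)) y' = dot (z *m M) (cross y y').
  by rewrite mul_cross_mx dot_crossC dotC.
rewrite !dotDl !dotNl h1 h2 h3 h4 h5 mulmxA mul_cross_mx; ring.
Qed.

Lemma cross_parallel A : (forall x, cross x (x *m A) = 0) -> exists c, A = c%:M.
Proof.
move=> h; exists (A i0 i0).
have E x i : cross x (x *m A) ord0 i = 0 by rewrite h mxE.
(* The basis vectors kill the off-diagonal entries; the vectors (1,1,0) and (1,0,1) equate the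
   diagonal ones. *)
have := (E (row3 1 0 0) i0, E (row3 1 0 0) i1, E (row3 1 0 0) i2,
  (E (row3 0 1 0) i0, E (row3 0 1 0) i1, E (row3 0 1 0) i2),
  (E (row3 0 0 1) i0, E (row3 0 0 1) i1, E (row3 0 0 1) i2),
  (E (row3 1 1 0) i2, E (row3 1 0 1) i1)).
rewrite /cross !(row3E, mulmx3E) =>
  -[[[[[e1 e2] e3] [[e4 e5] e6]] [[e7 e8] e9]] [e10 e11]].
by apply/matrixP; apply: ord3P; apply: ord3P; rewrite !mxE /= ?mulr1n ?mulr0n;
  lra.
Qed.

(** Every basis vector is a cross product. This converts the triple products produced by [psi] into
    matrix identities. *)
Lemma cross_spanP A B : (forall u v z,
  dot (cross u v *m A) z = dot (cross u v *m B) z) -> A = B.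
Proof.
move=> h; have e u v : cross u v *m A = cross u v *m B.
  apply/eqP; rewrite -subr_eq0; apply/eqP/dot_eq0 => z.
  by rewrite dotC dotDl dotNl h subrr.
have D : forall i, exists uv, delta_mx ord0 i = cross uv.1 uv.2 :> 'rV[R]_3.
  apply: ord3P.
  - exists (row3 0 1 0, row3 0 0 1).
    by apply: row3P; rewrite /cross !(row3E, mxE) /=; ring.
  - exists (row3 0 0 1, row3 1 0 0).
    by apply: row3P; rewrite /cross !(row3E, mxE) /=; ring.
  - exists (row3 1 0 0, row3 0 1 0).
    by apply: row3P; rewrite /cross !(row3E, mxE) /=; ring.
by apply/row_matrixP => i; rewrite !rowE; have [uv ->] := D i.
Qed.

End Classification.

Lemma unitmx_ker (F : fieldType) n (A : 'M[F]_n) :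
  (forall u : 'rV_n, u *m A = 0 -> u = 0) -> A \in unitmx.
Proof.
move=> kerA; rewrite -row_free_unit -kermx_eq0.
apply/eqP/row_matrixP => i; rewrite row0; apply: kerA.
by rewrite -row_mul mulmx_ker row0.
Qed.

(** The relation 2 q = k tr P is exactly what cancels the P^2 terms after Cayley-Hamilton has
    reduced P^3. *)
Lemma quad_Cayley_Hamilton (R : realFieldType) (P : 'M[R]_3) (q k : R) :
  let A := q%:M - k *: P in 2 * q = k * \tr P ->
  A *m A *m P = (q ^+ 2 - k ^+ 2 * sigma2 P) *: P + (k ^+ 2 * \det P)%:M.
Proof.
move=> A qk.
have AAE : A *m A = (q ^+ 2)%:M - (2 * q * k) *: P + k ^+ 2 *: (P *m P).
  rewrite /A mulmxBr !mulmxBl !mul_mx_scalar !mul_scalar_mx -!scalemxAl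
    -!scalemxAr.
  by apply/matrixP => i j; rewrite !mxE; ring.
rewrite AAE !mulmxDl mulNmx -!scalemxAl mul_scalar_mx Cayley_Hamilton3 qk.
move: (P *m P) => P2.
by apply/matrixP => i j; rewrite !mxE; case: (i == j); rewrite ?mulr1n ?mulr0n;
  ring.
Qed.

(** * The blocks of J in terms of P = M M^T *)

Section Structure.
Variable R : realFieldType.
Implicit Types (u v w x y z a b : 'rV[R]_3) (P Q : 'M[R]_3).

Lemma psi_cycle (W : 'M[R]_(3 + 3)) X Y Z : psi W X Y Z = psi W Y Z X.
Proof. by rewrite /psi; ring. Qed.

Variables (M A B C D : 'M[R]_3).
Let W := kahler_mx 0 0 M.
Let J : 'M[R]_(3 + 3) := block_mx A B C D.
Hypothesis Wu : W \in unitmx.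
Hypothesis JJ : J *m J = - 1%:M.
Hypothesis WJ : W *m J^T = - (J *m W).
Hypothesis psiJ : forall X Y Z, psi W (X *m J) Y Z = psi W X (Y *m J) Z.

Lemma mixed_unit : M \in unitmx.
Proof.
apply: unitmx_ker => x xM.
have : row_mx x 0 *m W = 0.
  by rewrite mul_kahler_mx xM mul0mx !cross0l subrr addr0 row_mx0.
move=> xW; have /eq_row_mx[] // : row_mx x 0 = row_mx 0 0 :> 'rV[R]_(3 + 3).
by rewrite row_mx0 -[LHS](mulmxK Wu) xW mul0mx.
Qed.

(** The form pairs (x, 0) with (0, z N) to the scalar product of x and z, so [N] carries the first
    factor to the dual of its image under [M]. *)
Let N := (invmx M)^T.
Let P := M *m M^T.
Let tau := \tr P.

Let psiJ' X Y Z : psi W (X *m J) Y Z = psi W X Y (Z *m J).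
Proof. by rewrite psiJ psi_cycle psiJ psi_cycle psi_cycle. Qed.

Let JE x y : row_mx x y *m J = row_mx (x *m A + y *m C) (x *m B + y *m D).
Proof. by rewrite mul_row_block. Qed.

Let simpl0 := (@crossvv, mul0mx, cross0l, cross0r, dot0l, dot0r, addr0, add0r,
  oppr0,
  subr0, sub0r).

Let MN : N *m M^T = 1%:M.
Proof. by rewrite -trmx_mul mulmxV ?trmx1 // mixed_unit. Qed.

Let NM : M^T *m N = 1%:M.
Proof. by rewrite -trmx_mul mulVmx ?trmx1 // mixed_unit. Qed.

Let PT : P^T = P.
Proof. by rewrite /P trmx_mul trmxK. Qed.

Let PN : P *m N = M.
Proof. by rewrite /P -mulmxA NM mulmx1. Qed.

(** Taking the last two arguments equal to Y makes psi(X J, Y, Y) vanish, hence psi(X, Y J, Y) = 0.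
    On the first factor this says that x B M^T is parallel to x for every x. *)
Lemma J_block_B : exists s, B *m M^T = s%:M.
Proof.
apply: cross_parallel => x; apply: dot_eq0 => x'.
have := psiJ (row_mx x' 0) (row_mx x 0) (row_mx x 0).
rewrite !JE /W !psiE !simpl0.
rewrite dot_mulmx => e.
have {}e : dot (cross x x') (x *m B *m M^T) = 0 by lra.
by rewrite dotC 2!dot_crossC [cross x' x]cross_anti dotNl mulmxA e oppr0.
Qed.

Lemma J_block_C : exists t, C *m M = t%:M.
Proof.
apply: cross_parallel => y; apply: dot_eq0 => y'.
have := psiJ (row_mx 0 y') (row_mx 0 y) (row_mx 0 y).
rewrite !JE /W !psiE !simpl0 => e.
have {}e : dot (y *m C *m M) (cross y y') = 0 by lra.
by rewrite dotC 2!dot_crossC [cross y' y]cross_anti dotNl mulmxA dotC e oppr0.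
Qed.

Variables (s t : R).
Hypothesis Bs : B *m M^T = s%:M.
Hypothesis Ct : C *m M = t%:M.
(** The factor with which [B] enters all later equations: B = s N, and cross products of images
    under [N] bring a factor 1 / det M. *)
Let k := s / \det M.

Let detM : \det M != 0.
Proof. by rewrite -unitfE -unitmxE mixed_unit. Qed.

Let BE : B = s *: N.
Proof.
by rewrite -[B]mulmx1 -NM mulmxA Bs mul_scalar_mx.
Qed.

Let cross_N u v : cross (u *m N) (v *m N) = (\det M)^-1 *: (cross u v *m M).
Proof.
have := cross_cofactor u v N; rewrite /N trmxK det_tr det_inv => e.
by rewrite -[LHS](mulmxKV mixed_unit) e scalemxAl.
Qed.

Let cross_M u v : cross (u *m M) (v *m M) *m M^T = \det M *: cross u v.
Proof. exact: cross_cofactor. Qed.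

Let dot_MN u v : dot (u *m M) (v *m N) = dot u v.
Proof. by rewrite dot_mulmx -mulmxA MN mulmx1. Qed.

Let dot_MM u v : dot (u *m M) (v *m M) = dot (u *m P) v.
Proof. by rewrite dotC dot_mulmx -mulmxA dotC. Qed.

Let dot_NA u v A' : dot u (v *m A') = dot (u *m A'^T) v.
Proof. by rewrite dotC dot_mulmx dotC. Qed.

(** Putting x' = x, antisymmetry forces x Q to be parallel to x. *)
Lemma cross_selfadjoint Q :
  (forall x x', cross (x *m Q) x' = cross x (x' *m Q)) -> exists q, Q = q%:M.
Proof.
move=> E; apply: cross_parallel => x; have := E x x.
rewrite cross_anti => /eqP; rewrite eq_sym -subr_eq0 opprK => /eqP e.
apply: row3P; rewrite [RHS]mxE.
- by have := congr1 (fun f : 'rV_3 => f ord0 i0) e;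
  rewrite /= [_ ord0 _]mxE [in RHS]mxE; lra.
- by have := congr1 (fun f : 'rV_3 => f ord0 i1) e;
  rewrite /= [_ ord0 _]mxE [in RHS]mxE; lra.
- by have := congr1 (fun f : 'rV_3 => f ord0 i2) e;
  rewrite /= [_ ord0 _]mxE [in RHS]mxE; lra.
Qed.

(** Moving J between two vectors of the first factor, with (0, z N) as third argument: [cross_N]
    turns the contribution of [B] into k P, so A + k P is self-adjoint for the cross product and
    therefore scalar. *)
Lemma J_block_A : exists q, A = q%:M - k *: P.
Proof.
suff [q qE] : exists q, A + k *: P = q%:M by exists q; rewrite -qE addrK.
apply: cross_selfadjoint => x x'.
apply/eqP; rewrite -subr_eq0; apply/eqP/dot_eq0 => z.
have := psiJ (row_mx x 0) (row_mx x' 0) (row_mx 0 (z *m N)).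
rewrite !JE /W !psiE !simpl0 BE -!scalemxAr !crossZl !crossZr !cross_N.
rewrite !dotZr !dot_MN !dot_MM => e.
have kE c : s * ((\det M)^-1 * c) = k * c by rewrite mulrA.
rewrite !kE in e.
have {}e : dot (cross (x *m A) x') z - dot (cross x (x' *m A)) z =
   k * dot (x' *m P) (cross z x) - k * dot (x *m P) (cross x' z) by lra.
rewrite dotC dotDl dotNl !mulmxDr -!scalemxAr crossDl crossDr crossZl crossZr.
rewrite !dotDl !dotZl [dot (cross (x *m P) x') z]dot_crossC.
rewrite [dot (cross x (x' *m P)) z]dot_crossC [dot (cross (x' *m P) z)
  x]dot_crossC.
rewrite [dot (cross x' z) _]dotC [dot (cross z x) _]dotC; lra.
Qed.

Variable q : R.
Hypothesis Aq : A = q%:M - k *: P.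

Let AT : A^T = A.
Proof. by rewrite Aq linearB /= tr_scalar_mx linearZ /= PT. Qed.

Lemma J_block_D : M *m D^T = - (A *m M).
Proof.
have := WJ; rewrite /W /J /kahler_mx tr_block_mx !mulmx_block => /eqP.
rewrite opp_block_mx => /eqP/eq_block_mx[_ + _ _].
by rewrite cross_mx0 !mul0mx mulmx0 addr0 add0r.
Qed.

Let ND : N *m D = - (A *m N).
Proof.
have DM : D *m M^T = - (M^T *m A).
  by rewrite -[LHS]trmxK trmx_mul trmxK J_block_D linearN /= trmx_mul AT.
by rewrite -[D]mulmx1 -NM [D *m _]mulmxA DM mulNmx mulmxN !mulmxA MN mul1mx.
Qed.

(** On the same vectors J is now moved to the third argument, where N D = - A N. This gives a second
    formula for [A] with k tau - q in place of q. *)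
Lemma J_block_A_trace : q + q = k * tau.
Proof.
have E : A = (k * tau - q)%:M - k *: P.
  apply: cross_spanP => x x' z.
  have := psiJ' (row_mx x 0) (row_mx x' 0) (row_mx 0 (z *m N)).
  rewrite !JE /W !psiE !simpl0 BE -!scalemxAr !crossZr !cross_N.
  rewrite -[z *m N *m D]mulmxA ND mulmxN dotNr mulmxA !dotZr !dot_MN !dot_MM =>
    e.
  have kE c : s * ((\det M)^-1 * c) = k * c by rewrite mulrA.
  rewrite kE dot_NA AT in e.
  have := congr1 (fun u => dot u z) (cross_trace x x' P).
  rewrite /= !dotDl dotNl dotZl PT -/tau => e'.
  have e2 : dot (cross (x *m A) x') z =
      q * dot (cross x x') z - k * dot (cross (x *m P) x') z.
    by rewrite Aq mulmxBr mul_mx_scalar -scalemxAr crossDl crossNl !crossZl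
      dotDl dotNl !dotZl.
  have e3 : dot (cross x (x' *m P)) z = dot (x' *m P) (cross z x).
    by rewrite 2!dot_crossC dotC.
  rewrite mulmxBr mul_mx_scalar -scalemxAr dotDl dotNl !dotZl.
  nra.
have := congr1 (fun F : 'M[R]_3 => F i0 i0) E; rewrite Aq !mxE /= !mulr1n; lra.
Qed.

Let MC : M *m C = t%:M.
Proof.
by rewrite -[C](mulmxK mixed_unit) Ct mul_scalar_mx -scalemxAr mulmxV
  ?mixed_unit // scalemx1.
Qed.

Let PA : P *m A = A *m P.
Proof. by rewrite Aq mulmxBr mulmxBl mul_mx_scalar mul_scalar_mx -scalemxAr
  -scalemxAl. Qed.

Let MDE : M *m D = - (A *m M).
Proof.
by rewrite -[D]mul1mx -NM -[M^T *m N *m D]mulmxA ND 2!mulmxN 2!mulmxA PA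
  -mulmxA PN.
Qed.

Let trA : \tr A = k * tau / 2.
Proof.
have h := J_block_A_trace.
by rewrite Aq linearB /= mxtrace_scalar linearZ /= -/tau -mulr_natl; lra.
Qed.

Let trAA : (\tr A)%:M - A = k *: P.
Proof.
have h := J_block_A_trace.
by rewrite {2}Aq opprB addrCA -raddfB /= trA (_ : _ - q = 0) ?raddf0 ?addr0 //;
  lra.
Qed.

Let P_neq0 : P != 0.
Proof.
apply/eqP => P0; have := detM; have := det_mulmx M M^T.
by rewrite -/P P0 det_tr det0 // => /esym/eqP; rewrite mulf_eq0 orbb => ->.
Qed.

(** Here one argument lies in the first factor and two, u M and v M, in the second. The outcome is a
    multiple of the nonzero matrix [P], whose coefficient is s + t because k det M = s. *)
Lemma J_block_t : t = - s.
Proof.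
suff E : (\det M * k + t) *: P = 0.
  move/eqP: E; rewrite scaler_eq0 (negPf P_neq0) orbF /k mulrC divfK // => /eqP.
  by move=> h; lra.
apply: trmx_inj; apply: (@cross_spanP R) => x u v; rewrite trmx0 mulmx0 dot0l.
have := psiJ (row_mx x 0) (row_mx 0 (u *m M)) (row_mx 0 (v *m M)).
rewrite !JE /W !psiE !simpl0 -[u *m M *m C]mulmxA MC mul_mx_scalar.
rewrite -[u *m M *m D]mulmxA MDE mulmxN mulmxA crossNl crossZr.
rewrite -scalemxAl dotZl dotNr ![dot (_ *m M) (cross _ _)]dot_mulmx dot_MM.
rewrite !cross_M !dotZr => e.
have tr_uv : dot x (cross (u *m A) v) + dot (x *m A) (cross u v) =
    k * dot (cross x u *m P) v.
  rewrite [dot (x *m A) _]dot_mulmx AT -dotDr.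
  have -> : cross (u *m A) v + cross u v *m A = k *: cross u (v *m P).
    rewrite -crossZr scalemxAr -trAA mulmxBr mul_mx_scalar crossDr crossZr
      crossNr.
    by rewrite -{2}AT -(addrK (cross u (v *m A)) (cross (u *m A) v))
      cross_trace addrAC subrK.
  by rewrite dotZr dotC 2!dot_crossC dot_NA PT.
rewrite linearZ /= PT -scalemxAr dotZl.
apply: (mulfI (_ : (1 : R) != 0)); first exact: oner_neq0.
rewrite mulr0 mul1r mulrDl -mulrA -tr_uv; lra.
Qed.

Let delta2 : \det P = \det M ^+ 2.
Proof. by rewrite det_mulmx det_tr. Qed.

(** The upper left block of J^2 = -1, multiplied by [P]: the scalar part s^2 of A^2 P cancels
    against B C P = - s^2, and what is left is a multiple of P. *)
Lemma J_normalization : k ^+ 2 * (sigma2 P - tau ^+ 2 / 4) = 1.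
Proof.
have BCP : B *m C *m P = (s * t)%:M.
  rewrite /P -mulmxA [C *m _]mulmxA Ct mul_scalar_mx -scalemxAr Bs.
  by rewrite scale_scalar_mx mulrC.
have AABC : A *m A + B *m C = - 1%:M.
  have := congr1 ulsubmx JJ.
  by rewrite /J mulmx_block block_mxKul [1%:M]scalar_mx_block opp_block_mx
    block_mxKul.
have APP : A *m A *m P = (q ^+ 2 - k ^+ 2 * sigma2 P) *: P + (s ^+ 2)%:M.
  have sE : s ^+ 2 = k ^+ 2 * \det P.
    by rewrite delta2 /k expr_div_n divfK // expf_neq0.
  by rewrite Aq quad_Cayley_Hamilton ?sE //; have := J_block_A_trace;
    rewrite -/tau; lra.
have : (q ^+ 2 - k ^+ 2 * sigma2 P + 1) *: P = 0.
  have := congr1 (fun F => F *m P) AABC; rewrite mulmxDl APP BCP J_block_t.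
  rewrite mulNmx mul1mx => e; rewrite scalerDl scale1r -[X in _ + X]opprK -e.
  by move: (P) (sigma2 P) => P' s2; apply/matrixP => i j; rewrite !mxE;
    case: (i == j); rewrite ?mulr1n ?mulr0n; ring.
move/eqP; rewrite scaler_eq0 (negPf P_neq0) orbF => /eqP.
have := J_block_A_trace => h.
have -> : q = k * tau / 2 by lra.
by rewrite expr_div_n => e; lra.
Qed.

Hypothesis NJ : forall X Y Z,
  form W (nijenhuis J X Y) Z = 4 / 3 * psi W X Y Z.

Let AA : A *m A = \tr A *: A + k ^+ 2 *: (P *m P - (tau / 2) *: P).
Proof.
have AA' : ((\tr A)%:M - A) *m A = \tr A *: A - A *m A.
  by rewrite mulmxBl mul_scalar_mx.
have -> : A *m A = \tr A *: A - ((\tr A)%:M - A) *m A by rewrite AA' opprB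
  addrC subrK.
congr (_ + _); rewrite trAA Aq mulmxBr mul_mx_scalar -!scalemxAl -!scalemxAr.
have -> : q = k * tau / 2 by have := J_block_A_trace; lra.
move: (P *m P) => P2.
by apply/matrixP => i j; rewrite !mxE; ring.
Qed.

Lemma quadratic_P : exists nu, P *m P = (tau / 2) *: P + nu%:M.
Proof.
have k2 : k ^+ 2 != 0.
  by apply: contra_eq_neq J_normalization => ->; rewrite mul0r eq_sym oner_eq0.
(* For two vectors of the first factor tested against (0, z N), only the block [A] enters the
   Nijenhuis tensor. By [cross_adjugate] and [cross_trace] the equation reads 2 (A^2 - tr A A) +
   sigma2 A - 1 = - 4/3. *)
suff E : A *m A - \tr A *: A = (- (sigma2 A + 3^-1) / 2)%:M.
  exists (k ^- 2 * (- (sigma2 A + 3^-1) / 2)).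
  rewrite -scale_scalar_mx -E AA addrAC subrr add0r scalerA mulVf // scale1r.
  by rewrite addrC subrK.
apply: (@cross_spanP R) => x x' z.
have := NJ (row_mx x 0) (row_mx x' 0) (row_mx 0 (z *m N)).
rewrite /nijenhuis /half_bracket !JE !row_mxKl !row_mxKr.
rewrite !opp_row_mx !add_row_mx /W form_kahler psiE !simpl0 !dot_MN.
rewrite cross_adjugate linearD linearB /= linearZ /= trmx_mul AT tr_scalar_mx.
have -> U : U - cross (x *m A) x' *m A - cross x (x' *m A) *m A =
    U - (\tr A *: (cross x x' *m A) - cross x x' *m (A *m A)).
  rewrite -addrA -opprD -mulmxDl cross_trace AT mulmxBl -scalemxAl.
  by rewrite -mulmxA.
set w := cross x x'.
rewrite mulmxDr !mulmxBr mul_mx_scalar -scalemxAr !dotDl !dotNl !dotDl !dotNl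
  !dotZl.
rewrite mul_mx_scalar !dotZl; lra.
Qed.

End Structure.

Section Isotropic.
Variable R : realFieldType.

(* Eliminating P^2 from the Cayley-Hamilton identity leaves an equation that is
   linear in P; its leading coefficient is nonzero because otherwise the trace
   of the hypothesis would contradict the sign condition. *)
Lemma quadratic_scalar (P : 'M[R]_3) (nu : R) :
  P *m P = (\tr P / 2) *: P + nu%:M -> 0 < sigma2 P - \tr P ^+ 2 / 4 ->
  exists p, P = p%:M.
Proof.
set tau := \tr P => PP disc.
have nuE : tau ^+ 2 / 2 - 2 * sigma2 P = 3 * nu.
  have := mxtrace_sqr P; rewrite PP linearD linearZ /= mxtrace_scalar -/tau.
  lra.
(* By [nuE] this coefficient is one third of the quantity assumed positive. *)
have c_neq0 : sigma2 P + nu - tau ^+ 2 / 4 != 0 by apply/eqP; lra.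
have E : (sigma2 P + nu - tau ^+ 2 / 4) *: P = (\det P + tau * nu / 2)%:M.
  have := Cayley_Hamilton3 P.
  rewrite PP mulmxDl -scalemxAl PP mul_scalar_mx -/tau => /eqP.
  rewrite -subr_eq0 => /eqP /matrixP e; apply/matrixP => i j.
  have := e i j; rewrite !mxE; case: (i == j); rewrite ?mulr1n ?mulr0n; lra.
exists ((sigma2 P + nu - tau ^+ 2 / 4)^-1 * (\det P + tau * nu / 2)).
by rewrite -scale_scalar_mx -E scalerA mulVf // scale1r.
Qed.

End Isotropic.

(** * Normal form of nearly Kaehler structures on the Lie algebra *)

Section Classification.
Variable R : rcfType.
Implicit Types (U : 'M[R]_3).

(** The Ledger-Obata metric with scale [s], pulled back by the rotation x -> x U of the first
    factor. [lo_acs] is e times its almost complex structure pulled back in the same way. *)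
Definition lo_gram (s : R) U : 'M[R]_(3 + 3) :=
  s *: block_mx 1%:M (- 2^-1 *: U) (- 2^-1 *: U^T) 1%:M.

Definition lo_acs (e : R) U : 'M[R]_(3 + 3) :=
  (e / Num.sqrt 3) *: block_mx 1%:M (2 *: U) (- 2 *: U^T) (- 1%:M).

Lemma skew_kahler (W : 'M[R]_(3 + 3)) : W^T = - W ->
  exists a b M, W = kahler_mx a b M.
Proof.
move=> Wskew; have skew3 (S : 'M[R]_3) : S^T = - S -> exists a, S = cross_mx a.
  move=> Sskew; exists (row3 (S i1 i2) (S i2 i0) (S i0 i1)).
  have Sji i j : S j i = - S i j by move/matrixP/(_ i j): Sskew; rewrite !mxE.
  have S0 i : S i i = 0 by have := Sji i i; lra.
  apply/matrixP; apply: ord3P; apply: ord3P; rewrite cross_mxE ?row3E ?S0 //;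
    by rewrite Sji ?opprK.
move: Wskew; rewrite -[W]submxK tr_block_mx opp_block_mx =>
  /eq_block_mx[ul ur dl dr].
have [a ->] := skew3 _ ul; have [b ->] := skew3 _ dr.
exists a, b, (ursubmx W); rewrite /kahler_mx; congr block_mx.
by rewrite dl opprK.
Qed.

Lemma form_inj n (A B : 'M[R]_n) : (forall X Y,
  form A X Y = form B X Y) -> A = B.
Proof.
move=> h; apply/matrixP => i j; have := h (delta_mx ord0 i) (delta_mx ord0 j).
by rewrite /form -!rowE trmx_delta -!colE !mxE.
Qed.

Lemma nearly_kahler_blocks (J G : 'M[R]_(3 + 3)) :
  G^T = G -> (forall X, X != 0 -> 0 < form G X X) ->
  J *m J = - 1%:M -> J *m G *m J^T = G ->
  (forall X Y Z, psi (J *m G) (X *m J) Y Z = psi (J *m G) X (Y *m J) Z) ->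
  (forall X Y Z, form (J *m G) (nijenhuis J X Y) Z = 4 / 3 * psi (J *m G) X Y
    Z) ->
  exists s e U, [/\ 0 < s, (e = 1 \/ e = -1), U *m U^T = 1%:M, \det U = 1 &
    G = lo_gram s U /\ J = lo_acs e U].
Proof.
move=> GT Gpos JJ JGJ psiJ NJ.
have GJT : G *m J^T = - (J *m G).
  have := congr1 (mulmx J) JGJ; rewrite !mulmxA JJ !mulNmx mul1mx => <-.
  by rewrite opprK.
have Gu : G \in unitmx.
  apply: unitmx_ker => X XG; apply/eqP; apply: contraT => /Gpos.
  by rewrite /form XG mul0mx mxE ltxx.
have Ju : J \in unitmx.
  have [] // := @mulmx1_unit R _ J (- J).
  by rewrite mulmxN JJ opprK.
have Wu : J *m G \in unitmx by rewrite unitmx_mul Ju Gu.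
have Wskew : (J *m G)^T = - (J *m G) by rewrite trmx_mul GT.
have WJ : (J *m G) *m J^T = - (J *m (J *m G)).
  by rewrite -mulmxA GJT mulmxN.
have [a [b [M WE]]] := skew_kahler Wskew.
rewrite WE in psiJ NJ Wu WJ.
have GE : G = - (J *m kahler_mx a b M) by rewrite -WE mulmxA JJ mulNmx mul1mx
  opprK.
have psiJ' X Y Z : psi (kahler_mx a b M) X (Y *m J) Z =
    psi (kahler_mx a b M) X Y (Z *m J).
  by rewrite psi_cycle psiJ -psi_cycle.
have skewS S : (forall X Y, form S (X *m J) Y = form S X (Y *m J)) ->
    J *m S = S *m J^T.
  move=> h; apply: form_inj => X Y; have := h X Y.
  by rewrite /form trmx_mul !mulmxA.
have [a0 b0] : a = 0 /\ b = 0.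
  apply: (kahler_mx_exact Wu JJ WJ) => z; apply: skewS => X Y.
  - have := form_psi_mx a b M z 0; have -> : psi_mx2 M 0 = 0.
      by rewrite /psi_mx2 mul0mx cross_mx0 mulmx0 trmx0 !oppr0 block_mx0.
    by rewrite addr0 => E; rewrite !E psiJ'.
  - have := form_psi_mx a b M 0 z; have -> : psi_mx1 M 0 = 0.
      by rewrite /psi_mx1 mul0mx cross_mx0 mul0mx trmx0 !oppr0 block_mx0.
    by rewrite add0r => E; rewrite !E psiJ'.
rewrite {}a0 {}b0 in psiJ NJ Wu WJ GE {WE psiJ'}.
rewrite -[J]submxK in psiJ NJ JJ WJ GE *.
move: (ulsubmx J) (ursubmx J) (dlsubmx J) (drsubmx J) psiJ NJ JJ WJ GE
  {GJT Ju Wskew skewS JGJ Gu} => A B C D psiJ NJ JJ WJ GE.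
have Mu := mixed_unit Wu.
have [s Bs] := J_block_B psiJ; have [t Ct] := J_block_C psiJ.
have [q Aq] := J_block_A Wu psiJ Bs.
have ts := J_block_t Wu WJ psiJ Bs Ct Aq.
have norm1 := J_normalization Wu JJ WJ psiJ Bs Ct Aq.
have [nu quad] := quadratic_P Wu JJ WJ psiJ Bs Ct Aq NJ.
have qk := J_block_A_trace Wu WJ psiJ Bs Aq; have MD := J_block_D WJ.
have {}GE : G = block_mx s%:M (- (A *m M)) (D *m M^T) s%:M.
  rewrite GE /kahler_mx cross_mx0 mulmx_block opp_block_mx !mulmx0 !addr0
    !add0r.
  by rewrite !mulmxN !opprK Bs Ct ts raddfN opprK.
(* The upper left block of G = - J W is B M^T = s, and [G] is positive definite. *)
have s_gt0 : 0 < s.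
  have x0 : row_mx (row3 1 0 0) 0 != 0 :> 'rV[R]_(3 + 3).
    rewrite -row_mx0; apply/eqP => /eq_row_mx[/matrixP/(_ ord0 i0)].
    by rewrite row3E mxE => /eqP; rewrite oner_eq0.
  have := Gpos _ x0; rewrite GE form_row_mx mul_row_block !mul0mx !addr0.
  by rewrite row_mxKl row_mxKr mul_mx_scalar dotZl dot0r /dot !row3E; lra.
pose k := s / \det M; pose P := M *m M^T.
have detM : \det M != 0 by rewrite -unitfE -unitmxE.
have k_neq0 : k != 0 by rewrite mulf_neq0 ?invr_eq0 // gt_eqF.
have disc : 0 < sigma2 P - \tr P ^+ 2 / 4.
  rewrite -(pmulr_rgt0 _ (_ : 0 < k ^+ 2)) ?norm1 //.
  by rewrite exprn_even_gt0.
have [p PE] : exists p, P = p%:M := quadratic_scalar quad disc.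
have sP : sigma2 P = 3 * p ^+ 2.
  by rewrite PE /sigma2 !mxE /= !mulr1n; ring.
have tP : \tr P = 3 * p by rewrite PE mxtrace_scalar; lra.
have dP : \det M ^+ 2 = p ^+ 3.
  by have := congr1 determinant PE; rewrite /P det_mulmx det_tr det_scalar.
(* For scalar P the normalization reads k^2 (3 p^2 - 9 p^2 / 4) = 1. *)
have kp : k ^+ 2 * p ^+ 2 = 4 / 3.
  by move: norm1; rewrite -/P -/k sP tP; lra.
have p_gt0 : 0 < p.
  have p_neq0 : p != 0.
    by apply: contra_eq_neq kp => ->; rewrite expr0n mulr0; apply/eqP; lra.
  rewrite lt_neqAle eq_sym p_neq0 /=.
  have := congr1 (fun F : 'M[R]_3 => F i0 i0) PE;
    rewrite /P mulmx3E !mxE mulr1n => <-.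
  by rewrite !addr_ge0 ?sqr_ge0.
have AE : A = (k * p / 2)%:M.
  rewrite Aq -/P -/k PE scale_scalar_mx -raddfB /=; congr _%:M.
  by rewrite -/P -/k tP in qk; lra.
have MTM : M^T *m M = p%:M.
  have pM : p^-1 *: M^T *m M = 1%:M.
    apply: mulmx1C; rewrite -scalemxAr -/P PE scale_scalar_mx mulVf //.
    by rewrite gt_eqF.
  by rewrite -[LHS]scale1r -(mulfV (lt0r_neq0 p_gt0)) -scalerA scalemxAl pM
    scalemx1.
have BE : B = (s / p) *: M.
  have : p *: B = s *: M.
    by rewrite -mul_mx_scalar -MTM mulmxA Bs mul_scalar_mx.
  by move=> h; rewrite mulrC -scalerA -h scalerA mulVf ?scale1r ?gt_eqF.
have CE : C = - (s / p) *: M^T.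
  have : p *: C = - s *: M^T.
    by rewrite -mul_mx_scalar -PE /P mulmxA Ct ts mul_scalar_mx.
  move=> h; have -> : - (s / p) = p^-1 * - s by rewrite mulrN mulrC.
  by rewrite -scalerA -h scalerA mulVf ?scale1r ?gt_eqF.
have DE : D = - (k * p / 2)%:M.
  have MD' : M *m D^T = M *m - (k * p / 2)%:M.
    by rewrite MD AE mulmxN mul_mx_scalar mul_scalar_mx.
  have := congr1 (fun F => (invmx M *m F)^T) MD'.
  by rewrite /= !mulmxA mulVmx // !mul1mx trmxK linearN /= tr_scalar_mx.
have DM : D *m M^T = - (k * p / 2) *: M^T.
  by rewrite DE mulNmx mul_scalar_mx scaleNr.
pose r := Num.sqrt (3 : R); pose m := Num.sqrt p.
have r2 : r ^+ 2 = 3 by rewrite sqr_sqrtr.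
have m2 : m ^+ 2 = p by rewrite sqr_sqrtr ?ltW.
have r_gt0 : 0 < r by rewrite sqrtr_gt0.
have m_gt0 : 0 < m by rewrite sqrtr_gt0.
(* Chosen so that A = k p / 2 equals e / sqrt 3; then [kp] says e^2 = 1. *)
pose e := k * p * r / 2.
have e2 : e ^+ 2 = 1.
  have -> : e ^+ 2 = (k ^+ 2 * p ^+ 2) * r ^+ 2 / 4 by rewrite /e; field.
  by rewrite r2 kp; lra.
(* From s = k det M and (det M)^2 = p^3 follows s^2 = k^2 p^3 = 4 p / 3. *)
have sE : s = 2 * m / r.
  apply/eqP; rewrite -(@eqrXn2 _ 2) ?divr_ge0 ?mulr_ge0 ?ltW //; apply/eqP.
  have -> : s = k * \det M by rewrite /k divfK.
  have -> : (k * \det M) ^+ 2 = (k ^+ 2 * p ^+ 2) * p.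
    by rewrite exprMn dP; ring.
  have -> : (2 * m / r) ^+ 2 = 4 * m ^+ 2 / r ^+ 2 by field; rewrite gt_eqF.
  by rewrite kp m2 r2; lra.
(* As s = k det M is positive, e has the sign of det M; this factor makes [U] orthogonal with
   determinant 1 in both cases. *)
pose U := (e / m) *: M.
have e_neq0 : e != 0 by rewrite -sqrf_eq0 e2 oner_neq0.
have UU : U *m U^T = 1%:M.
  rewrite /U linearZ /= -scalemxAl -scalemxAr scalerA -/P PE scale_scalar_mx.
  by congr _%:M; rewrite -expr2 expr_div_n e2 m2 mul1r mulVf ?gt_eqF.
have detU : \det U = 1.
  have d2 : \det U ^+ 2 = 1.
    by have := congr1 determinant UU; rewrite det_mulmx det_tr det1.
  have d_gt0 : 0 < \det U.
    rewrite /U detZ.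
    have -> : (e / m) ^+ 3 * \det M = e ^+ 2 * (k * \det M) * (p * r / 2) / m
      ^+ 3.
      by rewrite /e; field; rewrite gt_eqF.
    rewrite e2 mul1r /k divfK // divr_gt0 ?exprn_gt0 // mulr_gt0 // divr_gt0
      ?mulr_gt0 //.
  by apply/eqP; rewrite -(@eqrXn2 _ 2) ?ltW // d2 expr1n.
have MU : M = (e * m) *: U.
  rewrite /U scalerA (_ : _ * _ = 1) ?scale1r //.
  by rewrite mulrA -[e * m * e]mulrA [m * e]mulrC mulrA -expr2 e2 mul1r mulfV
    ?gt_eqF.
clearbody U.
have MT : M^T = (e * m) *: U^T by rewrite MU linearZ.
have er : k * p / 2 = e / r by rewrite /e; field; rewrite gt_eqF.
exists s, e, U; split=> //.
  by move/eqP: e2; rewrite sqrf_eq1 => /orP[]/eqP; [left|right].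
split.
  rewrite GE /lo_gram DM AE er mul_scalar_mx MT MU sE scale_block_mx.
  rewrite !scalerA !scale_scalar_mx -[- (_ *: U)]scaleNr !mulr1.
  have c : e / r * (e * m) = m / r.
    by have -> : e / r * (e * m) = e ^+ 2 * m / r; [field;
      rewrite gt_eqF|rewrite e2 mul1r].
  by congr (block_mx _ (_ *: _) (_ *: _) _); rewrite ?mulNr c; field;
    rewrite gt_eqF.
rewrite AE BE CE DE er MT MU /lo_acs scale_block_mx !scalerA.
have c : s / p * (e * m) = e / r * 2.
  rewrite sE -m2; field; rewrite !gt_eqF //.
congr block_mx.
- by rewrite scalemx1.
- by rewrite c.
- by congr (_ *: _); rewrite mulNr c; ring.
- by rewrite scalerN scalemx1.
Qed.
End Classification.

(** * The nearly Kaehler equations on a Lie algebra *)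

(* [c X Y Z] stands for g([X, Y], Z), so that [domega] is the
   exterior derivative of omega(X, Y) = g(J X, Y). *)
Section Koszul.
Variables (R : realFieldType) (V : Type) (c : V -> V -> V -> R) (J : V -> V).
Implicit Types X Y Z : V.

(** The Koszul formula for g(nabla_X Y, Z) on left-invariant fields: their scalar products are
    constant, so only the bracket terms occur. *)
Definition koszul X Y Z : R := (c X Y Z - c Y Z X + c Z X Y) / 2.

(** This is g((nabla_X J) Y, Z), the second term rewritten with the skewness of J for g. *)
Definition nablaJ_form X Y Z : R := koszul X (J Y) Z + koszul X Y (J Z).

Definition domega X Y Z : R := c X Y (J Z) + c Y Z (J X) + c Z X (J Y).

Hypothesis c_anti : forall X Y Z, c X Y Z = - c Y X Z.
Hypothesis cJJl : forall X Y Z, c (J (J X)) Y Z = - c X Y Z.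
Hypothesis cJJr : forall X Y Z, c X Y (J (J Z)) = - c X Y Z.
Hypothesis nk : forall X Y Z, nablaJ_form X Y Z = - nablaJ_form Y X Z.

Let T := nablaJ_form.

Let cJJm X Y Z : c X (J (J Y)) Z = - c X Y Z.
Proof. by rewrite c_anti cJJl -c_anti. Qed.

Let T23 X Y Z : T X Y Z = - T X Z Y.
Proof.
rewrite /T /nablaJ_form /koszul.
have := (c_anti X (J Y) Z, c_anti (J Y) Z X, c_anti Z X (J Y),
  c_anti X Y (J Z), c_anti Y (J Z) X, c_anti (J Z) X Y).
by move=> [[[[[h1 h2] h3] h4] h5] h6]; lra.
Qed.

(** Differentiating J^2 = -1 shows that nabla_X J anticommutes with J, and J is skew for g. *)
Let TJ X Y Z : T X (J Y) Z = T X Y (J Z).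
Proof.
by rewrite /T /nablaJ_form /koszul ?cJJl ?cJJr ?cJJm; lra.
Qed.

(** The cyclic sum of nabla omega consists of equal terms: [T] is skew in its last two arguments,
    and [nk] makes it totally skew. *)
Lemma domegaE X Y Z : domega X Y Z = 3 * nablaJ_form X Y Z.
Proof.
have h1 := nk X Y Z; have h2 := T23 X Y Z; have h3 := nk Z X Y.
have h4 := T23 Y Z X; rewrite /T in h2 h4.
have -> : domega X Y Z = T X Y Z + T Y Z X + T Z X Y.
  rewrite /domega /T /nablaJ_form /koszul.
  have := (c_anti X (J Y) Z, c_anti (J Y) Z X, c_anti Z X (J Y)).
  have := (c_anti X Y (J Z), c_anti Y (J Z) X, c_anti (J Z) X Y).
  have := (c_anti Y Z (J X), c_anti Z (J X) Y, c_anti (J X) Y Z).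
  move=> [[a1 a2] a3] [[b1 b2] b3] [[d1 d2] d3]; lra.
rewrite /T; lra.
Qed.

Lemma domega_acs X Y Z : domega (J X) Y Z = domega X (J Y) Z.
Proof.
rewrite !domegaE; have := TJ Y X Z; have := nk Y (J X) Z; have := nk Y X (J Z).
by have := TJ X Y Z; rewrite /T; lra.
Qed.

(** The left side is g of the Nijenhuis tensor with Z. The torsion-free connection expresses it by
    four terms in nabla J, each equal to T X Y (J Z). *)
Lemma nijenhuis_domega X Y Z :
  c (J X) (J Y) Z + c (J X) Y (J Z) + c X (J Y) (J Z) - c X Y Z =
  4 / 3 * domega X Y (J Z).
Proof.
have -> : c (J X) (J Y) Z + c (J X) Y (J Z) + c X (J Y) (J Z) - c X Y Z
   = T (J X) Y Z - T (J Y) X Z - T Y X (J Z) + T X Y (J Z).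
  rewrite /T /nablaJ_form /koszul ?cJJl ?cJJr ?cJJm.
  have := (c_anti (J X) (J Y) Z, c_anti (J Y) Z (J X), c_anti Z (J X) (J Y)).
  have := (c_anti X (J Y) (J Z), c_anti (J Y) (J Z) X, c_anti (J Z) X (J Y)).
  have := (c_anti (J X) Y (J Z), c_anti Y (J Z) (J X), c_anti (J Z) (J X) Y).
  have := (c_anti X Y Z, c_anti Y Z X, c_anti Z X Y).
  move=> [[a1 a2] a3] [[b1 b2] b3] [[d1 d2] d3] [[e1 e2] e3]; lra.
rewrite domegaE.
have := TJ X Y Z; have := TJ Y X Z; have := nk (J X) Y Z; have := nk (J Y) X Z.
have := nk X Y (J Z); rewrite /T; lra.
Qed.

End Koszul.

Section LeftInvariant.
Variable R : rcfType.

Lemma nearly_kahler_classification (J G : 'M[R]_(3 + 3)) :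
  G^T = G -> (forall X, X != 0 -> 0 < form G X X) ->
  J *m J = - 1%:M -> J *m G *m J^T = G ->
  let c X Y Z := form G (half_bracket X Y) Z in
  (forall X Y Z, nablaJ_form c (mulmxr J) X Y Z =
     - nablaJ_form c (mulmxr J) Y X Z) ->
  exists s e U, [/\ 0 < s, (e = 1 \/ e = -1), U *m U^T = 1%:M, \det U = 1 &
    G = lo_gram s U /\ J = lo_acs e U].
Proof.
move=> GT Gpos JJ JGJ c nk.
have c_anti X Y Z : c X Y Z = - c Y X Z.
  rewrite /c; have -> : half_bracket X Y = - half_bracket Y X.
    by rewrite /half_bracket opp_row_mx -!cross_anti.
  by rewrite /form !mulNmx mxE.
have JJE (X : 'rV[R]_(3 + 3)) : X *m J *m J = - X by rewrite -mulmxA JJ mulmxN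
  mulmx1.
have cJJr X Y Z : c X Y (Z *m J *m J) = - c X Y Z.
  by rewrite JJE /c /form linearN /= mulmxN mxE.
have hbN (X Y : 'rV[R]_(3 + 3)) : half_bracket (- X) Y = - half_bracket X Y.
  by rewrite /half_bracket !linearN /= opp_row_mx !crossNl.
have cJJl X Y Z : c (X *m J *m J) Y Z = - c X Y Z.
  by rewrite JJE /c hbN /form !mulNmx mxE.
have gJ X Y : form G X (Y *m J) = - form (J *m G) X Y.
  have := congr1 (mulmx J) JGJ; rewrite !mulmxA JJ !mulNmx mul1mx => <-.
  have -> : form (- (G *m J^T)) X Y = - form (G *m J^T) X Y.
    by rewrite /form mulmxN mulNmx mxE.
  by rewrite opprK /form trmx_mul !mulmxA.
have psiE' X Y Z : psi (J *m G) X Y Z = domega c (mulmxr J) X Y Z.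
  by rewrite /domega /c /= !gJ /psi; ring.
apply: nearly_kahler_blocks => // [X Y Z|X Y Z].
  by rewrite !psiE'; apply: (domega_acs c_anti cJJl cJJr nk).
(* Replacing Z by J Z turns g into omega on the left and, by J^2 = -1, removes J on the right. *)
have := nijenhuis_domega c_anti cJJl cJJr nk X Y (Z *m J).
have formBl S (U V W : 'rV[R]_(3 + 3)) : form S (U - V) W = form S U W - form S
  V W.
  by rewrite /form !mulmxBl !mxE.
have formN S (U V : 'rV[R]_(3 + 3)) : form S (- U) V = - form S U V.
  by rewrite /form !mulNmx mxE.
have formJJ U V : form G (U *m J) (V *m J) = form G U V.
  rewrite gJ; have -> : form (J *m G) (U *m J) V = form G (U *m J *m J) V.
    by rewrite /form !mulmxA.
  by rewrite JJE formN opprK.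
have cNl U V Q : c (- U) V Q = - c U V Q by rewrite /c hbN /form !mulNmx mxE.
have cNm U V Q : c U (- V) Q = - c U V Q by rewrite c_anti cNl -c_anti.
have -> : domega c (mulmxr J) X Y (mulmxr J (Z *m J)) = - domega c (mulmxr J) X
  Y Z.
  by rewrite /domega /= cJJr JJE cNl cNm; lra.
rewrite -psiE' /nijenhuis /= !cJJr => e.
rewrite -[form (J *m G) _ Z]opprK -gJ !formBl !formJJ.
by rewrite /c /= in e *; lra.
Qed.
End LeftInvariant.

(** * Smooth maps *)

Section Bilinear.
Context {R : realType}.

Lemma linear_rV_continuous (W : normedModType R) n (L : {linear 'rV[R]_n -> W})
  :
  continuous L.
Proof.
have -> : (L : _ -> _) = fun x => \sum_(i < n) x ord0 i *: L (delta_mx ord0 i).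
  apply/funext => x; rewrite {1}[x]row_sum_delta linear_sum.
  by apply: eq_bigr => i _; rewrite linearZ.
move=> x; apply: (@cvg_big _ _ +%R 0 xpredT _ _ (nbhs x)) => [|i _].
  exact: add_continuous.
by apply: (@cvgZr_tmp _ _ _ (nbhs x)); exact: coord_continuous.
Qed.

Lemma bilinear_rV_continuous (W V : normedModType R) n
    (B : {bilinear 'rV[R]_n -> V -> W}) :
  (forall u, continuous (B u)) -> continuous (fun p => B p.1 p.2).
Proof.
move=> Bc.
have -> : (fun p => B p.1 p.2) =
    fun p => \sum_(i < n) p.1 ord0 i *: B (delta_mx ord0 i) p.2.
  apply/funext => -[x y] /=; rewrite {1}[x]row_sum_delta linear_sumlz.
  by apply: eq_bigr => i _; rewrite linearZl_LR.
move=> p; apply: (@cvg_big _ _ +%R 0 xpredT _ _ (nbhs p)) => [|i _].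
  exact: add_continuous.
apply: (@cvgZ _ _ _ (nbhs p)).
  apply: (@continuous_comp _ _ _ fst (fun x : 'rV[R]_n => x ord0 i)).
    exact: cvg_fst.
  exact: coord_continuous.
apply: (@continuous_comp _ _ _ snd (B (delta_mx ord0 i))); first exact: cvg_snd.
exact: Bc.
Qed.

Global Instance is_diff_lin (U V W : normedModType R) (L : {linear V -> W})
    (f df : U -> V) x (Lc : continuous L) :
  is_diff x f df -> is_diff x (fun y => L (f y)) (fun v => L (df v)).
Proof.
move=> dfx; apply: (@is_diff_comp _ _ _ _ _ _ L L) => //.
by apply: DiffDef; [exact: linear_differentiable | rewrite diff_lin].
Qed.

Lemma is_diff_bilin (U V V' W : normedModType R) (B : {bilinear V -> V' -> W})
    (f df : U -> V) (g dg : U -> V') x (Bc : continuous (fun p => B p.1 p.2)) :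
  is_diff x f df -> is_diff x g dg ->
  is_diff x (fun y => B (f y) (g y)) (fun v => B (f x) (dg v) + B (df v) (g x)).
Proof.
move=> dfx dgx.
apply: (@is_diff_comp _ _ _ _ (fun y => (f y, g y)) (fun v => (df v, dg v))
  (fun p => B p.1 p.2) (fun q => B (f x) q.2 + B q.1 (g x))) => //.
by apply: DiffDef; [exact: differentiable_bilin | rewrite diff_bilin].
Qed.

End Bilinear.

Section SmoothClosure.
Context {R : realType}.
Implicit Types U V W : normedModType R.

Lemma ndifferentiable_diff V W k (f : V -> W) x :
  ndifferentiable k f -> differentiable f x.
Proof. by case: k => [|k] []. Qed.

(** In the Leibniz rule one factor stays undifferentiated, and the induction for products needs it
    at the lower order. *)
Lemma ndifferentiableS V W k (f : V -> W) :
  ndifferentiable k.+1 f -> ndifferentiable k f.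
Proof.
elim: k f => [|k IHk] f [df D]; first by split.
by split=> // v; apply: IHk; exact: D.
Qed.

Lemma derive_is_diff V W (f df : V -> W) x v : is_diff x f df -> 'D_v f x = df
  v.
Proof. by move=> fdf; rewrite deriveE // diff_val. Qed.

Lemma ndifferentiable_cst V W k (w : W) : ndifferentiable k (fun _ : V => w).
Proof.
elim: k w => [|k IHk] w; split => //; try by move=> x;
  exact: differentiable_cst.
move=> v; have -> : (fun x : V => 'D_v (fun=> w) x) = fun=> 0; last exact: IHk.
by apply/funext => x; exact: derive_cst.
Qed.

Lemma ndifferentiableD V W k (f g : V -> W) :
  ndifferentiable k f -> ndifferentiable k g -> ndifferentiable k (fun x =>
    f x + g x).
Proof.
elim: k f g => [|k IHk] f g [df Df] [dg Dg]; split => //;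
  try by move=> x; apply: differentiableD.
move=> v; have -> : (fun x => 'D_v (fun y => f y + g y) x) =
    fun x => 'D_v f x + 'D_v g x; last exact: IHk (Df v) (Dg v).
by apply/funext => x; rewrite deriveD //; exact: diff_derivable.
Qed.

Lemma ndifferentiable_lin U V W k (L : {linear V -> W}) (f : U -> V) :
  continuous L -> ndifferentiable k f -> ndifferentiable k (fun x => L (f x)).
Proof.
move=> Lc; have dL (h : U -> V) x : differentiable h x -> is_diff x (fun y =>
  L (h y)) (fun v => L ('d h x v)).
  by move=> /differentiableP dh; exact: is_diff_lin.
elim: k f => [|k IHk] f [df Df]; split => //;
  try by move=> x; have [] := dL _ _ (df x).
move=> v; have -> : (fun x => 'D_v (fun y => L (f y)) x) = fun x =>
  L ('D_v f x);
  last exact: IHk (Df v).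
apply/funext => x; have := dL _ _ (df x).
by move=> /derive_is_diff ->; rewrite deriveE.
Qed.

Lemma ndifferentiable_bilin U V V' W k (B : {bilinear V -> V' -> W})
    (f : U -> V) (g : U -> V') :
  continuous (fun p => B p.1 p.2) ->
  ndifferentiable k f -> ndifferentiable k g ->
  ndifferentiable k (fun x => B (f x) (g x)).
Proof.
move=> Bc.
have dB (h : U -> V) (h' : U -> V') x : differentiable h x -> differentiable h'
  x ->
    is_diff x (fun y => B (h y) (h' y)) (fun v =>
      B (h x) ('d h' x v) + B ('d h x v) (h' x)).
  by move=> /differentiableP dh /differentiableP dh'; exact: is_diff_bilin.
elim: k f g => [|k IHk] f g ndf ndg; have [df Df] := ndf; have [dg Dg] := ndg;
  split => //; try by move=> x; have [] := dB _ _ _ (df x) (dg x).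
move=> v.
have -> : (fun x => 'D_v (fun y => B (f y) (g y)) x) =
    fun x => B (f x) ('D_v g x) + B ('D_v f x) (g x); last first.
  by apply: ndifferentiableD; apply: IHk;
    [exact: ndifferentiableS|exact: Dg|exact: Df|exact: ndifferentiableS].
apply/funext => x; have := dB _ _ _ (df x) (dg x).
by move=> /derive_is_diff ->; rewrite !deriveE.
Qed.

Lemma ndifferentiable_pair U V W k (f : U -> V) (g : U -> W) :
  ndifferentiable k f -> ndifferentiable k g -> ndifferentiable k (fun x =>
    (f x, g x)).
Proof.
elim: k f g => [|k IHk] f g [df Df] [dg Dg]; split => //;
  try by move=> x; exact: differentiable_pair.
move=> v; have -> : (fun x => 'D_v (fun y => (f y, g y)) x) =
    fun x => ('D_v f x, 'D_v g x); last exact: IHk (Df v) (Dg v).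
apply/funext => x; rewrite !deriveE // ?diff_pair //;
  exact: differentiable_pair.
Qed.

Lemma ndifferentiable_id V k : ndifferentiable k (@id V).
Proof.
have did (x : V) : differentiable (@id V) x by exact: (@ex_diff _ _ _ _ _ id).
case: k => [|k]; split=> // v.
have -> : (fun x : V => 'D_v id x) = fun=> v; last exact: ndifferentiable_cst.
by apply/funext => x; rewrite derive_id.
Qed.

Lemma smooth_diff V W (f : V -> W) x : smooth f -> differentiable f x.
Proof. by move=> /(_ 0%N); exact: ndifferentiable_diff. Qed.

Lemma smooth_cst V W (w : W) : smooth (fun _ : V => w).
Proof. by move=> k; exact: ndifferentiable_cst. Qed.

Lemma smooth_id V : smooth (@id V).
Proof. by move=> k; exact: ndifferentiable_id. Qed.

Lemma smooth_lin U V W (L : {linear V -> W}) (f : U -> V) :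
  continuous L -> smooth f -> smooth (fun x => L (f x)).
Proof. by move=> Lc sf k; exact: ndifferentiable_lin. Qed.

Lemma smooth_bilin U V V' W (B : {bilinear V -> V' -> W}) (f : U -> V) (g : U
  -> V') :
  continuous (fun p => B p.1 p.2) -> smooth f -> smooth g ->
  smooth (fun x => B (f x) (g x)).
Proof. by move=> Bc sf sg k; exact: ndifferentiable_bilin. Qed.

Lemma smooth_pair U V W (f : U -> V) (g : U -> W) :
  smooth f -> smooth g -> smooth (fun x => (f x, g x)).
Proof. by move=> sf sg k; exact: ndifferentiable_pair. Qed.

Lemma smooth_fst U V W (f : U -> V * W) : smooth f -> smooth (fun x => (f x).1).
Proof. by apply: (@smooth_lin _ _ _ fst) => p; exact: cvg_fst. Qed.

Lemma smooth_snd U V W (f : U -> V * W) : smooth f -> smooth (fun x => (f x).2).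
Proof. by apply: (@smooth_lin _ _ _ snd) => p; exact: cvg_snd. Qed.

End SmoothClosure.

(** * Geometry of S3 x S3 *)

Section QuaternionAlgebra.
Context {R : realType}.
Implicit Types (x y z u v : quat R) (c : R).

Lemma quatP x y : qc x 0 = qc y 0 -> qc x 1 = qc y 1 -> qc x 2 = qc y 2 ->
  qc x 3 = qc y 3 -> x = y.
Proof.
move=> h0 h1 h2 h3; apply/rowP => i; rewrite -[i]inord_val.
by case: i => [[|[|[|[|//]]]] /= _].
Qed.

Lemma qmkE a b c d :
  (qc (qmk a b c d) 0 = a) * (qc (qmk a b c d) 1 = b)
  * (qc (qmk a b c d) 2 = c) * (qc (qmk a b c d) 3 = d :> R).
Proof. by rewrite /qc !mxE !inordK. Qed.

Lemma qcD x y k : qc (x + y) k = qc x k + qc y k. Proof. exact: mxE. Qed.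
Lemma qcN x k : qc (- x) k = - qc x k. Proof. exact: mxE. Qed.
Lemma qcZ c x k : qc (c *: x) k = c * qc x k. Proof. exact: mxE. Qed.
Lemma qc0 k : qc (0 : quat R) k = 0. Proof. exact: mxE. Qed.

Lemma qdotE x y : qdot x y =
  qc x 0 * qc y 0 + qc x 1 * qc y 1 + qc x 2 * qc y 2 + qc x 3 * qc y 3.
Proof.
rewrite /qdot !big_ord_recl big_ord0 addr0 /qc !addrA.
by do !congr (_ + _); congr (x _ _ * y _ _); apply/val_inj; rewrite /= inordK.
Qed.

Definition qE := (qmkE, qcD, qcN, qcZ, qc0, qdotE).
End QuaternionAlgebra.

Ltac quat_ring :=
  rewrite /qmul /qconj /q1; first [apply: quatP | idtac]; rewrite !qE; ring.

Section QuaternionIdentities.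
Context {R : realType}.
Implicit Types (x y z u v : quat R) (c : R).

Lemma qmulA x y z : qmul x (qmul y z) = qmul (qmul x y) z.
Proof. by quat_ring. Qed.
Lemma qmul1q x : qmul q1 x = x. Proof. by quat_ring. Qed.
Lemma qmulq1 x : qmul x q1 = x. Proof. by quat_ring. Qed.
Lemma qmulqV x : qmul x (qconj x) = qdot x x *: q1. Proof. by quat_ring. Qed.
Lemma qmulVq x : qmul (qconj x) x = qdot x x *: q1. Proof. by quat_ring. Qed.
Lemma qconjM x y : qconj (qmul x y) = qmul (qconj y) (qconj x).
Proof. by quat_ring. Qed.
Lemma qconjK x : qconj (qconj x) = x. Proof. by quat_ring. Qed.
Lemma qconj1 : qconj (q1 : quat R) = q1. Proof. by quat_ring. Qed.
Lemma qdot1 : qdot (q1 : quat R) q1 = 1. Proof. by quat_ring. Qed.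
Lemma qdot_mull a u v : qdot (qmul a u) (qmul a v) = qdot a a * qdot u v.
Proof. by quat_ring. Qed.
Lemma qdot_mulr a u v : qdot (qmul u a) (qmul v a) = qdot a a * qdot u v.
Proof. by quat_ring. Qed.
Lemma qdot_conj u v : qdot (qconj u) (qconj v) = qdot u v.
Proof. by quat_ring. Qed.
Lemma qdotC u v : qdot u v = qdot v u.
Proof. by quat_ring. Qed.

Lemma qmul_is_bilinear : bilinear_for (GRing.Scale.Law.clone _ _ *:%R _)
  (GRing.Scale.Law.clone _ _ *:%R _) (@qmul R).
Proof. by split=> x c u v /=; quat_ring. Qed.

Lemma qdot_is_bilinear : bilinear_for (GRing.Scale.Law.clone _ _ *:%R _)
  (GRing.Scale.Law.clone _ _ *:%R _) (@qdot R).
Proof. by split=> x c u v /=; rewrite /GRing.scale /=; quat_ring. Qed.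

Lemma qconj_is_linear : linear (@qconj R).
Proof. by move=> c u v; quat_ring. Qed.

End QuaternionIdentities.

HB.instance Definition _ (R : realType) := bilinear_isBilinear.Build R
  (quat R) (quat R) (quat R) _ _ (@qmul R) qmul_is_bilinear.
HB.instance Definition _ (R : realType) := bilinear_isBilinear.Build R
  (quat R) (quat R) R _ _ (@qdot R) qdot_is_bilinear.
HB.instance Definition _ (R : realType) := GRing.isLinear.Build R
  (quat R) (quat R) _ (@qconj R) qconj_is_linear.

Section SmoothQuaternions.
Context {R : realType}.
Implicit Types V : normedModType R.

Lemma qmul_continuous : continuous (fun p : quat2 R => qmul p.1 p.2).
Proof. by apply: bilinear_rV_continuous => u; exact: linear_rV_continuous. Qed.

Lemma qdot_continuous : continuous (fun p : quat2 R => qdot p.1 p.2).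
Proof. by apply: bilinear_rV_continuous => u; exact: linear_rV_continuous. Qed.

Lemma smooth_qmul V (f g : V -> quat R) : smooth f -> smooth g ->
  smooth (fun x => qmul (f x) (g x)).
Proof. exact/smooth_bilin/qmul_continuous. Qed.

Lemma smooth_qdot V (f g : V -> quat R) : smooth f -> smooth g ->
  smooth (fun x => qdot (f x) (g x)).
Proof. exact/smooth_bilin/qdot_continuous. Qed.

Lemma smooth_qconj V (f : V -> quat R) : smooth f -> smooth (fun x =>
  qconj (f x)).
Proof. exact/smooth_lin/linear_rV_continuous. Qed.

Lemma smooth_mul2 V (f g : V -> quat2 R) : smooth f -> smooth g ->
  smooth (fun x => mul2 (f x) (g x)).
Proof.
move=> sf sg; apply: smooth_pair; apply: smooth_qmul;
  by [exact: smooth_fst | exact: smooth_snd].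
Qed.

End SmoothQuaternions.

(** * Differentials on S3 x S3 through the retraction *)

Section Retraction.
Context {R : realType}.
Implicit Types (x y : quat R) (p q : quat2 R).

Definition normalize x : quat R := (qnorm x)^-1 *: x.

Lemma qnorm_S3 x : S3 x -> qnorm x = 1.
Proof. by rewrite /qnorm => ->; rewrite sqrtr1. Qed.

Lemma retraction_id p : S3xS3 p -> retraction p = p.
Proof.
by case: p => x y [/= xS yS];
  rewrite /retraction /= !qnorm_S3 // invr1 !scale1r.
Qed.

Lemma normalize_S3 x : 0 < qdot x x -> S3 (normalize x).
Proof.
move=> x_gt0; rewrite /S3 /= /normalize.
have -> : qdot ((qnorm x)^-1 *: x) ((qnorm x)^-1 *: x) =
    (qnorm x) ^- 2 * qdot x x.
  by rewrite !qdotE !qcZ -exprVn; ring.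
by rewrite /qnorm sqr_sqrtr ?ltW // mulVf // gt_eqF.
Qed.

Lemma near_retraction p : S3xS3 p -> \forall q \near p, S3xS3 (retraction q).
Proof.
case: p => x y [/= xS yS].
have pos (z : quat R) : S3 z -> \forall z' \near z, 0 < qdot z' z'.
  move=> zS; apply: (@cvgr_gt _ _ (nbhs z) _ (fun z' => qdot z' z') (qdot z z)).
    apply: (@differentiable_continuous R _ _ z (fun z' : quat R => qdot z' z')).
    by apply: smooth_diff; apply: smooth_qdot; exact: smooth_id.
  by rewrite zS ltr01.
have := pos _ xS; have := pos _ yS => Py Px.
exists ([set z | 0 < qdot z z], [set z | 0 < qdot z z]) =>
  //= -[x' y'] /= [x0 y0].
by split; exact: normalize_S3.
Qed.

(** Near p the retraction takes its values on the manifold, so values of F off it have no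
    influence. *)
Lemma dM_congr (W : normedModType R) (F G : quat2 R -> W) p (u : quat2 R) :
  S3xS3 p -> (forall q, S3xS3 q -> F q = G q) -> dM F p u = dM G p u.
Proof.
move=> pM FG; apply: near_eq_derive; near=> q => /=; apply: FG.
by near: q; exact: near_retraction.
Unshelve. all: by end_near. Qed.

(** The derivative of x / |x| at a unit vector is the orthogonal projection onto the tangent
    space. *)
Lemma is_diff_normalize x : S3 x ->
  is_diff x normalize (fun u => u - qdot x u *: x).
Proof.
move=> xS.
pose q2 y : R := qdot y y.
have dq : is_diff x q2 (fun u => qdot x u + qdot u x).
  exact: (is_diff_bilin qdot_continuous).
have q2x : q2 x = 1 by [].
have ds : is_diff (q2 x) (Num.sqrt : R -> R) (fun h => h *: 2^-1).
  rewrite q2x; have [d e] := is_derive1_sqrt (@ltr01 R).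
  apply: DiffDef; first exact/derivable1_diffP.
  by rewrite (deriv1E d) derive1E e sqrtr1 mulr1.
have di : is_diff (Num.sqrt (q2 x)) (GRing.inv : R -> R) (fun h => - h).
  rewrite q2x sqrtr1; apply: DiffDef; first exact/differentiable_Rinv/oner_neq0.
  rewrite diff_Rinv ?oner_neq0 //; apply/funext => h.
  by rewrite expr1n invr1 scaleN1r.
have dn : is_diff x (fun y => (qnorm y)^-1) (fun u => - qdot x u).
  have h := is_diff_comp (is_diff_comp dq ds) di.
  have -> : (fun y : quat R =>
    (qnorm y)^-1) = GRing.inv \o (Num.sqrt \o q2) by [].
  apply: (is_diff_eq h).
  apply/funext => u; rewrite /= [qdot u x]qdotC /GRing.scale /=; lra.
(* A real scalar is treated as the quaternion c [q1], so that the product rule for [qmul] applies to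
   the scaling. *)
have dn1 : is_diff x (fun y => (qnorm y)^-1 *: (q1 : quat R))
    (fun u => - qdot x u *: q1).
  have [dn' en] := dn; apply: DiffDef; first exact: differentiableZl.
  by rewrite diffZl // en.
have qmul_q1 c y : qmul (c *: q1) y = c *: y.
  by rewrite linearZl_LR /= qmul1q.
rewrite (_ : normalize = fun y => qmul ((qnorm y)^-1 *: q1) y); last first.
  by apply/funext => y; rewrite qmul_q1.
apply: (is_diff_eq (is_diff_bilin qmul_continuous dn1 (is_diff_id x))).
by apply/funext => u /=; rewrite !qmul_q1 qnorm_S3 // invr1 scale1r scaleNr.
Qed.

Lemma is_diff_fst_comp (V W U : normedModType R) (f df : V -> W) (p : V * U) :
  is_diff (p.1) f df -> is_diff p (fun z => f z.1) (fun z => df z.1).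
Proof.
move=> fdf; apply: (@is_diff_comp _ _ _ _ fst fst f df) => //.
have c : continuous (fst : V * U -> V) by move=> z; exact: cvg_fst.
by apply: DiffDef; [exact: (@linear_differentiable _ _ _ fst) | rewrite
  (@diff_lin _ _ _ fst)].
Qed.

Lemma is_diff_snd_comp (V W U : normedModType R) (f df : V -> W) (p : U * V) :
  is_diff (p.2) f df -> is_diff p (fun z => f z.2) (fun z => df z.2).
Proof.
move=> fdf; apply: (@is_diff_comp _ _ _ _ snd snd f df) => //.
have c : continuous (snd : U * V -> V) by move=> z; exact: cvg_snd.
by apply: DiffDef; [exact: (@linear_differentiable _ _ _ snd) | rewrite
  (@diff_lin _ _ _ snd)].
Qed.

(** The differential of the retraction fixes tangent vectors, so the differential in the ambient
    space can be used instead. *)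
Lemma dM_is_diff (W : normedModType R) (F dF : quat2 R -> W) p u :
  S3xS3 p -> tangent p u -> is_diff p F dF -> dM F p u = dF u.
Proof.
move=> pM [u1 u2] FdF.
have dr : is_diff p retraction (fun u =>
  (u.1 - qdot p.1 u.1 *: p.1, u.2 - qdot p.2 u.2 *: p.2)).
  have d1 := @is_diff_fst_comp _ _ (quat R) _ _ p (is_diff_normalize pM.1).
  have d2 := @is_diff_snd_comp _ _ (quat R) _ _ p (is_diff_normalize pM.2).
  exact: (is_diff_pair d1 d2).
have rp : is_diff (retraction p) F dF by rewrite retraction_id.
have h := is_diff_comp dr rp.
rewrite /dM (derive_is_diff _ h) /= u1 u2 !scale0r !subr0.
by case: (u).
Qed.

Lemma dM_cst (W : normedModType R) (F : quat2 R -> W) p u w :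
  S3xS3 p -> (forall q, S3xS3 q -> F q = w) -> dM F p u = 0.
Proof.
move=> pM Fw; rewrite (dM_congr (G := fun=> w)) //.
by rewrite /dM (_ : _ \o _ = cst w) ?derive_cst.
Qed.

End Retraction.

(** * Left-invariant frame and translations *)

Section Frame.
Context {R : realType}.
Implicit Types (p q u v xi eta zeta : quat2 R) (x y : 'rV[R]_3) (X Y Z :
  'rV[R]_(3 + 3)).

Definition base : quat2 R := (q1, q1).

Definition imq x : quat R := qmk 0 (x ord0 i0) (x ord0 i1) (x ord0 i2).
Definition imrow (a : quat R) : 'rV[R]_3 := row3 (qc a 1) (qc a 2) (qc a 3).

Definition frame X : quat2 R := (imq (lsubmx X), imq (rsubmx X)).
Definition coframe xi : 'rV[R]_(3 + 3) := row_mx (imrow xi.1) (imrow xi.2).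

Lemma imq_is_linear : linear imq.
Proof. by move=> c x y; apply: quatP; rewrite /imq !qE ?mxE; ring. Qed.
HB.instance Definition _ := GRing.isLinear.Build R _ _ _ imq imq_is_linear.

Lemma frame_is_linear : linear frame.
Proof. by move=> c X Y; rewrite /frame !linearP. Qed.
HB.instance Definition _ := GRing.isLinear.Build R _ _ _ frame frame_is_linear.

Lemma imrow_is_linear : linear imrow.
Proof. by move=> c a b; apply: row3P; rewrite /imrow !(row3E, mxE, qE). Qed.
HB.instance Definition _ := GRing.isLinear.Build R _ _ _ imrow imrow_is_linear.

Lemma frameP (a : R) X Y : frame (a *: X + Y) = a *: frame X + frame Y.
Proof. exact: frame_is_linear. Qed.

Lemma frame0 : frame 0 = 0. Proof. exact: linear0. Qed.

Lemma frameN X : frame (- X) = - frame X. Proof. exact: linearN. Qed.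

Lemma frameZ (a : R) X : frame (a *: X) = a *: frame X.
Proof. exact: linearZ. Qed.

Lemma coframeP (a : R) xi eta : coframe (a *: xi + eta) = a *: coframe xi +
  coframe eta.
Proof. by rewrite /coframe scale_row_mx add_row_mx -!imrow_is_linear. Qed.

Lemma imqK : cancel imq imrow.
Proof. by move=> x; apply: row3P; rewrite /imrow row3E /imq qE. Qed.

Lemma imrowK a : tangent_S3 q1 a -> imq (imrow a) = a.
Proof.
rewrite /tangent_S3 /= /q1 !qE => a0.
by apply: quatP; rewrite /imq !qE /imrow ?row3E //; lra.
Qed.

Lemma frameK : cancel frame coframe.
Proof. by move=> X; rewrite /coframe /= !imqK hsubmxK. Qed.

Lemma coframeK xi : tangent base xi -> frame (coframe xi) = xi.
Proof.
by case: xi => a b [ta tb]; rewrite /frame row_mxKl row_mxKr !imrowK.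
Qed.

Lemma tangent_imq x : tangent_S3 q1 (imq x).
Proof. by rewrite /tangent_S3 /= /q1 /imq !qE; ring. Qed.

Lemma tangent_frame X : tangent base (frame X).
Proof. by split; exact: tangent_imq. Qed.

Lemma frame_bracket X Y : mul2 (frame X) (frame Y) - mul2 (frame Y) (frame X) =
  2 *: frame (half_bracket X Y).
Proof.
have b x y : qmul (imq x) (imq y) - qmul (imq y) (imq x) = 2 *: imq (cross x y).
  by rewrite /qmul /imq; apply: quatP; rewrite !qE /cross ?row3E; ring.
rewrite /half_bracket /frame row_mxKl row_mxKr.
by congr pair; exact: b.
Qed.

Lemma base_S3 : S3xS3 base.
Proof. by split; exact: qdot1. Qed.

Lemma mul2_base p : mul2 p base = p.
Proof. by case: p => a b; rewrite /mul2 /= !qmulq1. Qed.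

Lemma base_mul2 p : mul2 base p = p.
Proof. by case: p => a b; rewrite /mul2 /= !qmul1q. Qed.

Lemma S3_mul (a b : quat R) : S3 a -> S3 b -> S3 (qmul a b).
Proof. by rewrite /S3 /= => aS bS; rewrite qdot_mull aS bS mulr1. Qed.

Lemma S3_conj (a : quat R) : S3 a -> S3 (qconj a).
Proof. by rewrite /S3 /= qdot_conj. Qed.

Lemma S3xS3_mul p q : S3xS3 p -> S3xS3 q -> S3xS3 (mul2 p q).
Proof. by move=> [? ?] [? ?]; split; exact: S3_mul. Qed.

Lemma S3xS3_inv p : S3xS3 p -> S3xS3 (inv2 p).
Proof. by move=> [? ?]; split; exact: S3_conj. Qed.

Lemma mul2A p q r : mul2 p (mul2 q r) = mul2 (mul2 p q) r.
Proof. by rewrite /mul2 /= !qmulA. Qed.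

Lemma mul2V p : S3xS3 p -> mul2 p (inv2 p) = base.
Proof. by move=> [h1 h2]; rewrite /mul2 /= !qmulqV h1 h2 !scale1r. Qed.

Lemma mulV2 p : S3xS3 p -> mul2 (inv2 p) p = base.
Proof. by move=> [h1 h2]; rewrite /mul2 /= !qmulVq h1 h2 !scale1r. Qed.

Lemma tangent_mul2 p u v : S3xS3 p -> tangent u v -> tangent (mul2 p u) (mul2 p
  v).
Proof.
move=> [p1 p2] [t1 t2]; split; rewrite /tangent_S3 /= qdot_mull.
  by rewrite p1 t1 mulr0.
by rewrite p2 t2 mulr0.
Qed.

Lemma tangent_left p xi : S3xS3 p -> tangent base xi -> tangent p (mul2 p xi).
Proof. by move=> pM t; rewrite -{1}[p]mul2_base; exact: tangent_mul2. Qed.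

Lemma tangentP p u v (c : R) : tangent p u -> tangent p v -> tangent p (c *: u
  + v).
Proof.
have qdotP (a b b' : quat R) : qdot a (c *: b + b') = c * qdot a b + qdot a b'.
  by quat_ring.
move=> [u1 u2] [v1 v2]; split; rewrite /tangent_S3 /= qdotP.
  by rewrite u1 v1 mulr0 addr0.
by rewrite u2 v2 mulr0 addr0.
Qed.

Lemma left_field xi : tangent base xi ->
  vector_field S3xS3 tangent (fun p => mul2 p xi).
Proof.
move=> t; split; last by move=> p pM; exact: tangent_left.
exists (fun p => mul2 p xi); split=> //.
by apply: smooth_mul2; [exact: smooth_id | exact: smooth_cst].
Qed.

Lemma is_diff_mul2 (F dF H dH : quat2 R -> quat2 R) p :
  is_diff p F dF -> is_diff p H dH ->
  is_diff p (fun q => mul2 (F q) (H q))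
    (fun u => mul2 (F p) (dH u) + mul2 (dF u) (H p)).
Proof.
have fstd (K dK : quat2 R -> quat2 R) : is_diff p K dK ->
    is_diff p (fun q => (K q).1) (fun u => (dK u).1).
  by apply: (@is_diff_lin _ _ _ _ fst) => z; exact: cvg_fst.
have sndd (K dK : quat2 R -> quat2 R) : is_diff p K dK ->
    is_diff p (fun q => (K q).2) (fun u => (dK u).2).
  by apply: (@is_diff_lin _ _ _ _ snd) => z; exact: cvg_snd.
move=> dF' dH'.
have d1 := is_diff_bilin qmul_continuous (fstd _ _ dF') (fstd _ _ dH').
have d2 := is_diff_bilin qmul_continuous (sndd _ _ dF') (sndd _ _ dH').
exact: (is_diff_pair d1 d2).
Qed.

Lemma dM_left_field xi p u : S3xS3 p -> tangent p u ->
  dM (fun q => mul2 q xi) p u = mul2 u xi.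
Proof.
move=> pM tu; rewrite (dM_is_diff pM tu (is_diff_mul2 (is_diff_id p)
  (is_diff_cst xi p))).
by rewrite /mul2 /= !linear0r !add0r.
Qed.

Lemma dM_translation a p u : S3xS3 p -> tangent p u -> dM (mul2 a) p u = mul2 a
  u.
Proof.
move=> pM tu; rewrite (dM_is_diff pM tu (is_diff_mul2 (is_diff_cst a p)
  (is_diff_id p))).
by rewrite /mul2 /= !linear0l !addr0.
Qed.

End Frame.

(** Serves for g and J read in the frame, whose linearity is available only as a hypothesis on
    tangent vectors. *)
Lemma linear_form_rV (R : comNzRingType) n (f : 'rV[R]_n -> R) :
  (forall a u v, f (a *: u + v) = a * f u + f v) ->
  forall X, f X = \sum_(i < n) X ord0 i * f (delta_mx ord0 i).
Proof.
move=> fl X; have f0 : f 0 = 0.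
  have /esym/eqP := fl 1 0 0; rewrite scaler0 addr0 mul1r -subr_eq0 addrK.
  by move/eqP.
have fD u v : f (u + v) = f u + f v by rewrite -{1}[u]scale1r fl mul1r.
rewrite {1}[X]row_sum_delta (big_morph f fD f0); apply: eq_bigr => i _.
by rewrite -[_ *: _]addr0 fl f0 addr0.
Qed.

Lemma bilinear_form_gram (R : comNzRingType) n (b : 'rV[R]_n -> 'rV[R]_n -> R) :
  (forall v a u u', b (a *: u + u') v = a * b u v + b u' v) ->
  (forall u a v v', b u (a *: v + v') = a * b u v + b u v') ->
  forall X Y, b X Y =
    (X *m (\matrix_(i, j) b (delta_mx ord0 i) (delta_mx ord0 j)) *m Y^T) ord0
      ord0.
Proof.
move=> bl br X Y; rewrite (linear_form_rV (bl Y)) mxE.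
under [RHS]eq_bigr do rewrite !mxE mulr_suml.
rewrite exchange_big /=; apply: eq_bigr => i _.
rewrite (linear_form_rV (br _)) mulr_sumr.
by apply: eq_bigr => j _; rewrite !mxE mulrAC mulrA.
Qed.

(** * Reduction of the geometric hypotheses to the Lie algebra *)

Section LeviCivita.
Context {R : realType}.
Variables (g : quat2 R -> quat2 R -> quat2 R -> R) (J : quat2 R -> quat2 R ->
  quat2 R).
Variable nabla : (quat2 R -> quat2 R) -> (quat2 R -> quat2 R) -> quat2 R ->
  quat2 R.
Hypotheses (gJ_hermitian : almost_hermitian g J) (gJ_invariant : left_invariant
  g J).
Hypothesis nabla_LC : levi_civita g nabla.
Implicit Types (p q u v xi eta zeta : quat2 R).

Let o : quat2 R := base.
Let oS : S3xS3 o := base_S3.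

Let g_inner p : S3xS3 p -> inner_product (tangent p) (g p).
Proof. by case: gJ_hermitian => -[+ _] _ _ _ _; apply. Qed.

Let gB u v zeta : tangent o u -> tangent o v -> tangent o zeta ->
  g o (u - v) zeta = g o u zeta - g o v zeta.
Proof.
have [_ gD _] := g_inner oS; move=> tu tv tz.
by rewrite -scaleN1r [u + _]addrC gD // mulN1r addrC.
Qed.

Let gNl u zeta : tangent o u -> tangent o zeta -> g o (- u) zeta = - g o u zeta.
Proof.
have [_ gD _] := g_inner oS; move=> tu tz.
have := gD (-1) u (u - u) zeta tu _ tz; rewrite subrr addr0 scaleN1r => ->.
  by rewrite -(subrr u) gB // subrr addr0 mulN1r.
by rewrite -(subrr u) -scaleN1r addrC; exact: tangentP.
Qed.

Lemma metric_left_invariant p xi eta : S3xS3 p -> tangent o xi -> tangent o eta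
  ->
  g p (mul2 p xi) (mul2 p eta) = g o xi eta.
Proof.
move=> pM tx te; have [/(_ o xi eta oS tx te) + _] := gJ_invariant pM.
by rewrite !dM_translation // mul2_base.
Qed.

Lemma acs_left_invariant p xi : S3xS3 p -> tangent o xi ->
  J p (mul2 p xi) = mul2 p (J o xi).
Proof.
move=> pM tx; have [_ /(_ o xi oS tx)] := gJ_invariant pM.
have [_ Jt _ _ _] := gJ_hermitian; have [tJ _] := Jt _ _ oS tx.
by rewrite !dM_translation // mul2_base.
Qed.

(** The formula is required only on the manifold: J applied to a left-invariant field has this shape
    there, but is arbitrary elsewhere. *)
Definition left_frame xi (X : quat2 R -> quat2 R) : Prop :=
  [/\ tangent o xi, vector_field S3xS3 tangent X &
     forall q, S3xS3 q -> X q = mul2 q xi].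

Lemma left_frame_left xi : tangent o xi -> left_frame xi (fun q => mul2 q xi).
Proof. by move=> t; split=> //; exact: left_field. Qed.

Lemma left_frame_base xi X : left_frame xi X -> X o = xi.
Proof. by move=> [_ _ ->//]; rewrite base_mul2. Qed.

Let bracket xi eta : quat2 R := mul2 xi eta - mul2 eta xi.

Lemma lie_bracket_left xi eta X Y : left_frame xi X -> left_frame eta Y ->
  lie_bracket X Y o = bracket xi eta.
Proof.
move=> fX fY; have [tx _ XE] := fX; have [ty _ YE] := fY.
rewrite /lie_bracket (left_frame_base fX) (left_frame_base fY).
by rewrite (dM_congr eta oS XE) (dM_congr xi oS YE) !dM_left_field.
Qed.

Let c xi eta zeta : R := g o (bracket xi eta) zeta.

(** Three instances of metric compatibility and three of vanishing torsion, solved as a linear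
    system. *)
Lemma koszul_formula xi eta zeta X Y Z :
  left_frame xi X -> left_frame eta Y -> left_frame zeta Z ->
  g o (nabla X Y o) zeta = koszul c xi eta zeta.
Proof.
move=> fX fY fZ; have [tx vX XE] := fX; have [ty vY YE] := fY;
  have [tz vZ ZE] := fZ.
have [nabla_field _ _ torsion metric] := nabla_LC.
have [gC gD _] := g_inner oS.
have parallel xi' eta' zeta' X' Y' Z' : left_frame xi' X' -> left_frame eta' Y'
  ->
    left_frame zeta' Z' -> g o (nabla Z' X' o) eta' + g o (nabla Z' Y' o) xi' =
      0.
  move=> fX' fY' fZ'; have [tx' vX' XE'] := fX'; have [ty' vY' YE'] := fY'.
  have [tz' vZ' ZE'] := fZ'.
  have := metric _ _ _ vX' vY' vZ' _ oS.
  (* By left invariance the scalar product of the two fields is constant on the manifold. *)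
  rewrite (@dM_cst _ _ _ _ _ (g o xi' eta')) // => [|q qM]; last first.
    by rewrite XE' // YE' // metric_left_invariant.
  rewrite (left_frame_base fX') (left_frame_base fY') => ->; congr (_ + _).
  by rewrite gC //; exact: (nabla_field _ _ vZ' vY').2.
have tors xi' eta' zeta' X' Y' : left_frame xi' X' -> left_frame eta' Y' ->
    tangent o zeta' ->
    g o (nabla X' Y' o) zeta' - g o (nabla Y' X' o) zeta' = c xi' eta' zeta'.
  move=> fX' fY' tz'; have [tx' vX' XE'] := fX'; have [ty' vY' YE'] := fY'.
  rewrite /c -(lie_bracket_left fX' fY') -torsion //.
  have t1 := (nabla_field _ _ vX' vY').2 _ oS.
  have t2 := (nabla_field _ _ vY' vX').2 _ oS.
  by rewrite gB.
have := (parallel _ _ _ _ _ _ fX fY fZ, parallel _ _ _ _ _ _ fY fZ fX,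
  parallel _ _ _ _ _ _ fZ fX fY).
have := (tors _ _ _ _ _ fX fY tz, tors _ _ _ _ _ fY fZ tx,
  tors _ _ _ _ _ fZ fX ty).
by rewrite /koszul => -[[e1 e2] e3] [[e4 e5] e6]; lra.
Qed.

Hypothesis nk : nearly_kahler nabla J.

(** Left invariance of J makes J Y again left-invariant, so the Koszul formula applies to both terms
    of nabla J. *)
Lemma nablaJ_anti xi eta zeta : tangent o xi -> tangent o eta -> tangent o zeta
  ->
  nablaJ_form c (J o) xi eta zeta = - nablaJ_form c (J o) eta xi zeta.
Proof.
have [_ Jt Jl Jfield Jg] := gJ_hermitian.
have [gC gD _] := g_inner oS.
have [nabla_field _ _ _ _] := nabla_LC.
have fJ xi' : tangent o xi' -> left_frame (J o xi') (fun q => J q (mul2 q xi')).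
  move=> t; split; first exact: (Jt _ _ oS t).1.
    by apply: Jfield; exact: left_field.
  by move=> q qM; exact: acs_left_invariant.
have E xi' eta' zeta' : tangent o xi' -> tangent o eta' -> tangent o zeta' ->
    g o (nabla_J nabla J (fun q => mul2 q xi') (fun q => mul2 q eta') o) zeta' =
    nablaJ_form c (J o) xi' eta' zeta'.
  move=> tx te tz; rewrite /nabla_J /nablaJ_form.
  have fx := left_frame_left tx; have fe := left_frame_left te.
  have fz := left_frame_left tz; have [tJz JJz] := Jt _ _ oS tz.
  have [_ vx _] := fx; have [_ ve _] := fe.
  rewrite -(koszul_formula fx (fJ _ te) fz) -(koszul_formula fx fe
    (left_frame_left tJz)).
  have t1 := (nabla_field _ _ vx ve).2 _ oS.
  have [tJ1 JJ1] := Jt _ _ oS t1.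
  have [_ vJ _] := fJ _ te.
  have t2 := (nabla_field _ _ vx vJ).2 _ oS.
  rewrite gB //; congr (_ + _).
  by have := Jg _ _ _ oS tJ1 tz; rewrite JJ1 gNl // => <-; rewrite opprK.
move=> tx te tz.
have vx := left_field tx; have ve := left_field te.
rewrite -!E // nk // gNl //.
have t1 := (nabla_field _ _ ve vx).2 _ oS.
have [_ vJ _] := fJ _ tx; have t2 := (nabla_field _ _ ve vJ).2 _ oS.
have [tJ1 _] := Jt _ _ oS t1.
by rewrite /nabla_J -scaleN1r addrC; exact: tangentP.
Qed.

Lemma frame_classification : exists s e U,
  [/\ 0 < s, (e = 1 \/ e = -1), U *m U^T = 1%:M, \det U = 1 &
   (forall X Y, g o (frame X) (frame Y) = form (lo_gram s U) X Y) /\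
   (forall X, J o (frame X) = frame (X *m lo_acs e U))].
Proof.
have [_ Jt Jl _ Jg] := gJ_hermitian.
have [gC gD gpos] := g_inner oS.
have tf := @tangent_frame R.
pose G : 'M[R]_(3 + 3) :=
  \matrix_(i, j) g o (frame (delta_mx ord0 i)) (frame (delta_mx ord0 j)).
pose Jm : 'M[R]_(3 + 3) :=
  \matrix_(i, j) coframe (J o (frame (delta_mx ord0 i))) ord0 j.
have gE X Y : g o (frame X) (frame Y) = form G X Y.
  apply: (@bilinear_form_gram _ _ (fun X Y => g o (frame X) (frame Y))) =>
    [V a U U'|U a V V'].
    by rewrite frameP gD.
  by rewrite gC // frameP gD // (gC (frame V)) // (gC (frame V')).
have JE X : J o (frame X) = frame (X *m Jm).
  rewrite -[LHS]coframeK; last exact: (Jt _ _ oS (tf X)).1.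
  congr frame; apply/rowP => j; rewrite [RHS]mxE.
  rewrite (@linear_form_rV _ _ (fun X => coframe (J o (frame X)) ord0 j)).
    by apply: eq_bigr => i _; rewrite [in RHS]mxE.
  move=> a U V; rewrite frameP Jl // coframeP.
  by rewrite [LHS]mxE [X in X + _]mxE.
have c2 X Y Z : c (frame X) (frame Y) (frame Z) = 2 * form G (half_bracket X Y)
  Z.
  rewrite /c /bracket frame_bracket -frameZ gE /form -!scalemxAl.
  by rewrite mxE.
have frame_inj : injective (@frame R) by exact: can_inj (@frameK R).
have JJ : Jm *m Jm = - 1%:M.
  apply/row_matrixP => i; rewrite !rowE mulmxA mulmxN mulmx1; apply: frame_inj.
  by rewrite -!JE (Jt _ _ oS (tf _)).2 frameN.
have GT : G^T = G by apply/matrixP => i j; rewrite !mxE gC.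
have Gpos X : X != 0 -> 0 < form G X X.
  move=> X0; rewrite -gE; apply: gpos => //.
  by apply: contra_neq X0 => h; apply: frame_inj; rewrite h frame0.
have JGJ : Jm *m G *m Jm^T = G.
  apply: form_inj => X Y; rewrite -gE -(Jg _ _ _ oS (tf X) (tf Y)) !JE gE.
  by rewrite /form trmx_mul !mulmxA.
(* The condition is homogeneous in the bracket, so the factor 2 of [c2] disappears. *)
have nkX X Y Z : nablaJ_form (fun X Y Z =>
  form G (half_bracket X Y) Z) (mulmxr Jm) X Y Z
    = - nablaJ_form (fun X Y Z =>
      form G (half_bracket X Y) Z) (mulmxr Jm) Y X Z.
  have := nablaJ_anti (tf X) (tf Y) (tf Z).
  by rewrite /nablaJ_form /koszul !JE !c2 /=; lra.
have [s [e [U [s0 e1 UU dU [GE JmE]]]]] := nearly_kahler_classification GT Gpos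
  JJ JGJ nkX.
by exists s, e, U; split=> //; split=> [X Y|X]; rewrite ?gE ?JE ?GE ?JmE.
Qed.

End LeviCivita.

(** * The Ledger-Obata structure *)

Section Rotation.
Context {R : realType}.
Implicit Types (U : 'M[R]_3) (a b : quat R) (x y : 'rV[R]_3).

Definition rot U a : quat R := qc a 0 *: q1 + imq (imrow a *m U).

Lemma rot_is_linear U : linear (rot U).
Proof.
move=> c a b; rewrite /rot imrow_is_linear mulmxDl -scalemxAl imq_is_linear qcD
  qcZ.
by rewrite scalerDl scalerDr -scalerA addrACA.
Qed.
HB.instance Definition _ U := GRing.isLinear.Build R _ _ _ (rot U)
  (rot_is_linear U).

Lemma qc_rot U a : qc (rot U a) 0 = qc a 0.
Proof. by rewrite /rot /q1 /imq !qE; ring. Qed.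

Lemma imrow_rot U a : imrow (rot U a) = imrow a *m U.
Proof. by rewrite /imrow; apply: row3P; rewrite row3E /rot /q1 /imq !qE;
  ring. Qed.

Lemma qsplitP a b : qc a 0 = qc b 0 -> imrow a = imrow b -> a = b.
Proof.
move=> h0 h; apply: quatP => //.
- by have := congr1 (fun x : 'rV_3 => x ord0 i0) h; rewrite !row3E.
- by have := congr1 (fun x : 'rV_3 => x ord0 i1) h; rewrite !row3E.
- by have := congr1 (fun x : 'rV_3 => x ord0 i2) h; rewrite !row3E.
Qed.

Lemma qc_mul a b : qc (qmul a b) 0 = qc a 0 * qc b 0 - dot (imrow a) (imrow b).
Proof. by rewrite /qmul qmkE /dot !row3E; ring. Qed.

Lemma imrow_mul a b : imrow (qmul a b) =
  qc a 0 *: imrow b + qc b 0 *: imrow a + cross (imrow a) (imrow b).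
Proof.
by apply: row3P; rewrite /qmul /cross /imrow !(qE, row3E, mxE) /=; ring.
Qed.

Lemma qdot_split a b : qdot a b = qc a 0 * qc b 0 + dot (imrow a) (imrow b).
Proof. by rewrite qdotE /dot !row3E; ring. Qed.

Lemma rotK U : U *m U^T = 1%:M -> cancel (rot U) (rot U^T).
Proof.
by move=> UU a; apply: qsplitP;
  rewrite !(qc_rot, imrow_rot) // -mulmxA UU mulmx1.
Qed.

Lemma rot_q1 U : rot U q1 = q1.
Proof.
apply: qsplitP; rewrite ?qc_rot ?imrow_rot //.
rewrite (_ : imrow q1 = 0) ?mul0mx //.
by apply: row3P; rewrite row3E /q1 qE mxE.
Qed.

Lemma rot_imq U x : rot U (imq x) = imq (x *m U).
Proof. by apply: qsplitP; rewrite ?(qc_rot, imrow_rot) ?imqK // /imq !qE. Qed.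

Lemma dot_orthogonal U x y : U *m U^T = 1%:M -> dot (x *m U) (y *m U) = dot x y.
Proof. by move=> UU; rewrite dot_mulmx -mulmxA UU mulmx1. Qed.

Lemma qdot_rot U a b : U *m U^T = 1%:M -> qdot (rot U a) (rot U b) = qdot a b.
Proof. by move=> UU; rewrite !qdot_split !qc_rot !imrow_rot dot_orthogonal. Qed.

(** Orthogonality preserves the real part of a product, and determinant 1 is what the cross product
    in the imaginary part requires. *)
Lemma rot_mul U a b : U *m U^T = 1%:M -> \det U = 1 ->
  rot U (qmul a b) = qmul (rot U a) (rot U b).
Proof.
move=> UU dU; have VU := mulmx1C UU.
apply: qsplitP; rewrite !(qc_rot, imrow_rot, qc_mul,
  imrow_mul) ?dot_orthogonal //.
rewrite !mulmxDl -!scalemxAl; congr (_ + _).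
have := cross_cofactor (imrow a) (imrow b) U; rewrite dU scale1r => <-.
by rewrite -mulmxA VU mulmx1.
Qed.

End Rotation.

Section LedgerObata.
Context {R : realType}.
Implicit Types (p q m u v xi eta : quat2 R) (a b : quat R) (c : R).

Definition scaled_metric c : quat R -> quat R -> quat R -> R := fun _ a b =>
  c * qdot a b.

Lemma qdot_gt0 a : a != 0 -> 0 < qdot a a.
Proof.
move=> a0; rewrite lt_neqAle eq_sym qdotE !addr_ge0 ?sqr_ge0 // andbT.
apply: contra_neq a0 => h; apply: quatP; rewrite qc0.
all: have := (sqr_ge0 (qc a 0), sqr_ge0 (qc a 1), sqr_ge0 (qc a 2),
  sqr_ge0 (qc a 3)).
all: move=> [[[h0 h1] h2] h3]; apply/eqP; rewrite -sqrf_eq0; apply/eqP; nra.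
Qed.

Lemma scaled_biinvariant c : 0 < c -> biinvariant_metric (scaled_metric c).
Proof.
move=> c0; split; last first.
  move=> a d x u v aS dS xS tu tv; rewrite /scaled_metric.
  by rewrite qdot_mulr qdot_mull aS dS !mul1r.
split=> [a aS|X Y [[X' [sX XE]] _] [[Y' [sY YE]] _]]; last first.
  exists (fun a => qdot (qmul (c *: q1) (X' a)) (Y' a)); split.
    by apply: smooth_qdot => //; apply: smooth_qmul => //; exact: smooth_cst.
  move=> a aS; rewrite /scaled_metric XE // YE //.
  by move: (X' a) (Y' a) => x y; quat_ring.
split=> [a1 a2 _ _|d a1 a2 a3 _ _ _|a1 _ a10].
- by rewrite /scaled_metric qdotC.
- by rewrite /scaled_metric; quat_ring.
- by rewrite mulr_gt0 // qdot_gt0.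
Qed.

Definition lo_form c xi eta : R :=
  c * (qdot xi.1 eta.1 + qdot xi.2 eta.2 - 2^-1 * (qdot xi.1 eta.2 + qdot xi.2
    eta.1)).

(* |X - S|^2 + |Y - S|^2 + |S|^2 = 2/3 (|X|^2 + |Y|^2 - <X, Y>) for
   S = (X + Y) / 3, whence the factor 3/2. *)
Lemma lo_metricE c p u v : lo_metric (scaled_metric (3 / 2 * c)) p u v =
  lo_form c (mul2 (inv2 p) u) (mul2 (inv2 p) v).
Proof.
rewrite /lo_metric /lo_lift /scaled_metric /lo_form /=.
move: (qmul _ _) (qmul _ _) (qmul _ _) (qmul _ _) => a1 a2 b1 b2.
by rewrite !qE; field.
Qed.

Lemma lo_metric_left c p xi eta : S3xS3 p ->
  lo_metric (scaled_metric (3 / 2 * c)) p (mul2 p xi) (mul2 p eta) = lo_form c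
    xi eta.
Proof. by move=> pM; rewrite lo_metricE !mul2A mulV2 // !base_mul2. Qed.

(** The differential of [lo_theta] at the base point, on tangent vectors. *)
Definition lo_rotation xi : quat2 R := (- xi.2, xi.1 - xi.2).

Lemma lo_form_rotation c xi eta :
  lo_form c (lo_rotation xi) (lo_rotation eta) = lo_form c xi eta.
Proof. by rewrite /lo_form /lo_rotation /=; rewrite !qE; field. Qed.

(** Invariance under the diagonal adjoint action, which absorbs the conjugation by p.2 in the
    differential of [lo_theta] away from the base point. *)
Lemma lo_form_Ad c a xi eta : S3 a ->
  lo_form c (mul2 (mul2 (a, a) xi) (qconj a, qconj a))
            (mul2 (mul2 (a, a) eta) (qconj a, qconj a)) = lo_form c xi eta.
Proof.
move=> aS; rewrite /lo_form /mul2 /= !qdot_mulr !qdot_mull qdot_conj aS.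
by rewrite !mul1r.
Qed.

Definition lo_theta_diff p u : quat2 R :=
  (qconj u.2, qmul p.1 (qconj u.2) + qmul u.1 (qconj p.2)).

Lemma is_diff_lo_theta p : is_diff p lo_theta (lo_theta_diff p).
Proof.
have d1 : is_diff p (fst : quat2 R -> quat R) fst.
  exact: (is_diff_fst_comp (is_diff_id _)).
have cq : continuous (@qconj R) by exact: linear_rV_continuous.
have dq : is_diff (p.2) (@qconj R) (@qconj R).
  by apply: DiffDef; [exact: linear_differentiable | rewrite diff_lin].
have d2 := @is_diff_snd_comp _ _ _ (quat R) _ _ p dq.
have -> : lo_theta = fun q : quat2 R => (qconj q.2, qmul q.1 (qconj q.2)).
  by apply/funext => q; rewrite /lo_theta /lo_class qmul1q.
exact: (is_diff_pair d2 (is_diff_bilin qmul_continuous d1 d2)).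
Qed.

Lemma qconj_tangent a : tangent_S3 q1 a -> qconj a = - a.
Proof. by rewrite /tangent_S3 /= /q1 !qE => h; apply: quatP;
  rewrite /qconj !qE; lra. Qed.

Lemma S3xS3_lo_theta p : S3xS3 p -> S3xS3 (lo_theta p).
Proof.
move=> [h1 h2]; rewrite /lo_theta /lo_class; split; apply: S3_mul => //.
- exact: qdot1.
- exact: S3_conj.
- exact: S3_conj.
Qed.

Lemma qmulNl a b : qmul (- a) b = - qmul a b. Proof. by quat_ring. Qed.
Lemma qmulNr a b : qmul a (- b) = - qmul a b. Proof. by quat_ring. Qed.
Lemma qmulBl a a' b : qmul (a - a') b = qmul a b - qmul a' b.
Proof. by quat_ring. Qed.
Lemma qmulBr a b b' : qmul a (b - b') = qmul a b - qmul a b'.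
Proof. by quat_ring. Qed.

(* In left trivializations the differential of [lo_theta] at p is
   [lo_rotation] followed by the conjugation by p.2. *)
Lemma lo_theta_diff_left p xi : S3xS3 p -> tangent base xi ->
  lo_theta_diff p (mul2 p xi) =
  mul2 (lo_theta p) (mul2 (mul2 (p.2, p.2) (lo_rotation xi)) (qconj p.2,
    qconj p.2)).
Proof.
move=> [p1 p2] [t1 t2]; rewrite /lo_theta_diff /lo_theta /lo_class /mul2 /=.
rewrite !qmul1q !qconjM (qconj_tangent t2) !qmulA qmulVq p2 scale1r qmul1q.
rewrite -[qmul (qmul p.1 (qconj p.2)) p.2]qmulA qmulVq p2 scale1r qmulq1.
move: (p.1) (p.2) (xi.1) (xi.2) => a b x y.
by rewrite !qmulBr !qmulBl qmulNr [qmul (- qmul _ _) _]qmulNl addrC.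
Qed.

Lemma is_diff_lo_symmetry m p :
  is_diff p (lo_symmetry m)
    (fun u => mul2 m (lo_theta_diff (mul2 (inv2 m) p) (mul2 (inv2 m) u))).
Proof.
have trans n q : is_diff q (mul2 n) (mul2 n).
  apply: (is_diff_eq (is_diff_mul2 (is_diff_cst n q) (is_diff_id q))).
  by apply/funext => u; rewrite /mul2 /= !linear0l !addr0.
exact: (is_diff_comp (is_diff_comp (trans _ _) (is_diff_lo_theta _)) (trans m
  _)).
Qed.

Lemma smooth_lo_symmetry (V : normedModType R) m (f : V -> quat2 R) :
  smooth f -> smooth (fun x => lo_symmetry m (f x)).
Proof.
move=> sf; have sh : smooth (fun x => mul2 (inv2 m) (f x)).
  by apply: smooth_mul2 => //; exact: smooth_cst.
apply: smooth_mul2; first exact: smooth_cst.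
have s2 := smooth_qconj (smooth_snd sh).
apply: smooth_pair; apply: smooth_qmul => //; first exact: smooth_cst.
exact: smooth_fst.
Qed.

Lemma S3xS3_lo_symmetry m p : S3xS3 m -> S3xS3 p -> S3xS3 (lo_symmetry m p).
Proof.
move=> mM pM; apply: S3xS3_mul => //; apply: S3xS3_lo_theta.
by apply: S3xS3_mul => //; exact: S3xS3_inv.
Qed.

Lemma lo_theta2 p : S3xS3 p ->
  lo_theta (lo_theta p) = (qmul p.2 (qconj p.1), qconj p.1).
Proof.
move=> [_ p2]; rewrite /lo_theta /lo_class /= !qmul1q !qconjM !qconjK.
by rewrite qmulA qmulVq p2 scale1r qmul1q.
Qed.

Lemma lo_theta3 p : S3xS3 p -> lo_theta (lo_theta (lo_theta p)) = p.
Proof.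
move=> pM; rewrite (lo_theta2 pM); case: p pM => a b [/= a1 _].
rewrite /lo_theta /lo_class /= qmul1q qconjK -qmulA qmulVq a1 scale1r qmulq1.
by [].
Qed.

Lemma lo_symmetry3 m p : S3xS3 m -> S3xS3 p ->
  lo_symmetry m (lo_symmetry m (lo_symmetry m p)) = p.
Proof.
move=> mM pM; rewrite /lo_symmetry !mul2A !mulV2 // !base_mul2 lo_theta3.
  by rewrite mul2A mul2V // base_mul2.
by apply: S3xS3_mul => //; exact: S3xS3_inv.
Qed.

Lemma lo_theta_base : lo_theta base = base :> quat2 R.
Proof. by rewrite /lo_theta /lo_class /= qconj1 !qmulq1. Qed.

Lemma lo_symmetry_fixed m : S3xS3 m -> lo_symmetry m m = m.
Proof. by move=> mM; rewrite /lo_symmetry mulV2 // lo_theta_base mul2_base. Qed.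

(* A fixed point (a, b) satisfies a^3 = 1, so the real part of a is 1 or
   -1/2. *)
Lemma lo_theta_isolated p : S3xS3 p -> 0 < qc p.1 0 -> lo_theta p = p -> p =
  base.
Proof.
case: p => a b [/= aS bS] a0; rewrite /lo_theta /lo_class /= qmul1q => -[ba].
have := aS; rewrite /S3 /= qdotE => aN.
rewrite ba => bE; have {bE} : a = qconj (qmul a a) by rewrite bE -ba.
move=> aa; have := congr1 (fun z : quat R => qc z 0) aa.
rewrite /qconj /qmul !qmkE => e0.
have /eqP : (qc a 0 - 1) * (2 * qc a 0 + 1) = 0 by nra.
rewrite mulf_eq0 => /orP[/eqP e|/eqP e]; last by exfalso; lra.
have a1 : a = q1.
  by apply: quatP; rewrite /q1 !qE; nra.
have b1 : b = q1 by rewrite -[b]qconjK ba a1 qconj1.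
by rewrite a1 b1.
Qed.

Lemma mul2_inv_left p u : S3xS3 p -> mul2 p (mul2 (inv2 p) u) = u.
Proof. by move=> pM; rewrite mul2A mul2V // base_mul2. Qed.

Lemma mul2_left_inv p u : S3xS3 p -> mul2 (inv2 p) (mul2 p u) = u.
Proof. by move=> pM; rewrite mul2A mulV2 // base_mul2. Qed.

Lemma tangent_inv_left p u : S3xS3 p -> tangent p u -> tangent base (mul2 (inv2
  p) u).
Proof.
by move=> pM t; rewrite -(mulV2 pM); apply: tangent_mul2 => //;
  exact: S3xS3_inv.
Qed.

Lemma dM_lo_symmetry m p xi : S3xS3 m -> S3xS3 p -> tangent base xi ->
  let q := mul2 (inv2 m) p in
  dM (lo_symmetry m) p (mul2 p xi) =
  mul2 (lo_symmetry m p) (mul2 (mul2 (q.2, q.2) (lo_rotation xi)) (qconj q.2,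
    qconj q.2)).
Proof.
move=> mM pM t q; have qM : S3xS3 q by apply: S3xS3_mul => //; exact: S3xS3_inv.
rewrite (dM_is_diff pM (tangent_left pM t) (is_diff_lo_symmetry m p)) mul2A -/q.
by rewrite lo_theta_diff_left // mul2A.
Qed.

Lemma tangent_Ad a (x : quat R) : S3 a -> tangent_S3 q1 x ->
  tangent_S3 q1 (qmul (qmul a x) (qconj a)).
Proof.
move=> aS tx; rewrite /tangent_S3 /=.
have {1}-> : (q1 : quat R) = qmul (qmul a q1) (qconj a).
  by rewrite qmulq1 qmulqV aS scale1r.
by rewrite qdot_mulr qdot_mull tx !mulr0.
Qed.

Lemma tangent_lo_rotation xi : tangent base xi -> tangent base (lo_rotation xi).
Proof.
rewrite /tangent /tangent_S3 /= /q1 !qE => -[h1 h2].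
by split; rewrite /= ?qE; lra.
Qed.

Lemma tangent_dM_lo_symmetry m p xi : S3xS3 m -> S3xS3 p -> tangent base xi ->
  tangent (lo_symmetry m p) (dM (lo_symmetry m) p (mul2 p xi)).
Proof.
move=> mM pM t; rewrite dM_lo_symmetry //.
apply: tangent_left; first exact: S3xS3_lo_symmetry.
have [_ q2] : S3xS3 (mul2 (inv2 m) p) by apply: S3xS3_mul => //;
  exact: S3xS3_inv.
have [r1 r2] := tangent_lo_rotation t.
by split; exact: tangent_Ad.
Qed.

Lemma lo_symmetry_isometry c m p xi eta :
  S3xS3 m -> S3xS3 p -> tangent base xi -> tangent base eta ->
  lo_metric (scaled_metric (3 / 2 * c)) (lo_symmetry m p)
    (dM (lo_symmetry m) p (mul2 p xi)) (dM (lo_symmetry m) p (mul2 p eta)) =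
  lo_metric (scaled_metric (3 / 2 * c)) p (mul2 p xi) (mul2 p eta).
Proof.
move=> mM pM tx te; rewrite !dM_lo_symmetry // lo_metric_left; last first.
  exact: S3xS3_lo_symmetry.
rewrite lo_metric_left // lo_form_Ad ?lo_form_rotation //.
by have [] : S3xS3 (mul2 (inv2 m) p) by apply: S3xS3_mul => //;
  exact: S3xS3_inv.
Qed.

(** At m itself the conjugation is trivial, so J is 2 / sqrt 3 times [lo_rotation] plus one half of
    the identity. *)
Lemma lo_J_left m xi : S3xS3 m -> tangent base xi ->
  lo_J m (mul2 m xi) =
  mul2 m ((Num.sqrt 3)^-1 *: (xi.1 - 2 *: xi.2, 2 *: xi.1 - xi.2)).
Proof.
move=> mM t; rewrite /lo_J dM_lo_symmetry // lo_symmetry_fixed // mulV2 //.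
have qZ (k : R) a b : qmul a (k *: b) = k *: qmul a b by quat_ring.
rewrite /mul2 /= !qmul1q qconj1 !qmulq1.
have E a b d : (2 / Num.sqrt 3) *: (qmul a b + 2^-1 *: qmul a d) =
    qmul a ((2 / Num.sqrt 3) *: (b + 2^-1 *: d)).
  by rewrite qZ; congr (_ *: _); quat_ring.
rewrite -[LHS]/(_ *: (_ + 2^-1 *: _), _ *: (_ + 2^-1 *: _)) !E.
have r0 : Num.sqrt 3 != 0 :> R by rewrite gt_eqF // sqrtr_gt0.
have E2 a b d : a = (Num.sqrt 3)^-1 *: d -> qmul b a = qmul b ((Num.sqrt 3)^-1
  *: d).
  by move=> ->.
by congr pair; apply: E2; apply: quatP; rewrite !qE; field.
Qed.

End LedgerObata.

(** * Transport of the Ledger-Obata structure by linear automorphisms *)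

Section LinearAutomorphism.
Context {R : realType}.
Implicit Types (p q m u v xi eta : quat2 R) (F G : quat2 R -> quat2 R).

(** Linearity on all of H x H makes [F] its own differential. Smoothness is stated for composites so
    that it passes through chains of maps. *)
Record linear_automorphism F : Prop := LinearAutomorphism {
  la_linear : linear F;
  la_smooth : forall (V : normedModType R) (f : V -> quat2 R),
    smooth f -> smooth (fun x => F (f x));
  la_mul : forall p q, F (mul2 p q) = mul2 (F p) (F q);
  la_S3 : forall p, S3xS3 p -> S3xS3 (F p);
  la_base : F base = base;
  la_tangent : forall xi, tangent base xi -> tangent base (F xi) }.

Section Theory.
Variables (F G : quat2 R -> quat2 R).
Hypotheses (Fa : linear_automorphism F) (Ga : linear_automorphism G).
Hypotheses (FK : cancel F G) (GK : cancel G F).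

Lemma la_zero : F 0 = 0.
Proof.
have /esym/eqP := la_linear Fa 1 0 0; rewrite scaler0 addr0 scale1r.
by rewrite -subr_eq0 addrK => /eqP.
Qed.

Lemma la_scale c u : F (c *: u) = c *: F u.
Proof. by rewrite -[c *: u]addr0 (la_linear Fa) la_zero addr0. Qed.

Lemma la_is_diff p : is_diff p F F.
Proof.
have sF : smooth F by apply: (la_smooth Fa); exact: smooth_id.
pose L : {linear quat2 R -> quat2 R} :=
  HB.pack F (GRing.isLinear.Build _ _ _ _ F (la_linear Fa)).
have Lc : continuous L by move=> x; apply: differentiable_continuous;
  exact: smooth_diff.
by apply: DiffDef; [exact: smooth_diff | exact: (diff_lin p Lc)].
Qed.

Lemma la_dM p u : S3xS3 p -> tangent p u -> dM F p u = F u.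
Proof. by move=> pM tu; rewrite (dM_is_diff pM tu (la_is_diff p)). Qed.

Lemma la_diffeomorphism : diffeomorphism F.
Proof.
split; [by exists F; split=> //; apply: (la_smooth Fa);
  exact: smooth_id | exact: la_S3 |].
exists G; split; [by exists G; split=> //; apply: (la_smooth Ga);
  exact: smooth_id | exact: la_S3 |].
by move=> p _; rewrite FK GK.
Qed.

Lemma la_lie_group : lie_group_automorphism F.
Proof. by split; [exact: la_diffeomorphism | move=> p q _ _;
  exact: la_mul]. Qed.

Lemma la_inv p : S3xS3 p -> F (inv2 p) = inv2 (F p).
Proof.
move=> pM; have FpM := la_S3 Fa pM.
by rewrite -[LHS](mul2_left_inv _ FpM) -(la_mul Fa) mul2V // (la_base Fa)
  mul2_base.
Qed.

End Theory.

Lemma left_decomposition p u : S3xS3 p -> tangent p u ->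
  exists2 xi, tangent base xi & u = mul2 p xi.
Proof.
move=> pM tu; exists (mul2 (inv2 p) u); first exact: tangent_inv_left.
by rewrite mul2_inv_left.
Qed.

Section Transport.
Variables (g : quat2 R -> quat2 R -> quat2 R -> R) (J : quat2 R -> quat2 R ->
  quat2 R).
Variables (F G : quat2 R -> quat2 R) (s : R).
Hypotheses (gJ_hermitian : almost_hermitian g J) (gJ_invariant : left_invariant
  g J).
Hypotheses (Fa : linear_automorphism F) (Ga : linear_automorphism G).
Hypotheses (FK : cancel F G) (GK : cancel G F).
Hypothesis g_base : forall xi eta, tangent base xi -> tangent base eta ->
  g base xi eta = lo_form s (F xi) (F eta).
Hypothesis J_base : forall xi, tangent base xi -> F (J base xi) =
  (Num.sqrt 3)^-1 *: ((F xi).1 - 2 *: (F xi).2, 2 *: (F xi).1 - (F xi).2).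

Local Notation lo := (lo_metric (scaled_metric (3 / 2 * s))).

Lemma transport_metric p u v : S3xS3 p -> tangent p u -> tangent p v ->
  lo (F p) (F u) (F v) = g p u v.
Proof.
move=> pM /(left_decomposition pM)[xi tx ->] /(left_decomposition pM)[eta te
  ->].
rewrite !(la_mul Fa) lo_metric_left; last exact: la_S3.
by rewrite (metric_left_invariant gJ_invariant) // g_base.
Qed.

Lemma transport_acs p u : S3xS3 p -> tangent p u -> F (J p u) = lo_J (F p) (F
  u).
Proof.
move=> pM /(left_decomposition pM)[xi tx ->].
rewrite (acs_left_invariant gJ_hermitian gJ_invariant) // !(la_mul Fa)
  lo_J_left.
- by rewrite J_base.
- exact: la_S3.
- exact: la_tangent.
Qed.

Lemma acs_tangent p u : S3xS3 p -> tangent p u -> tangent p (J p u).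
Proof. by move=> pM tu; have [_ /(_ p u pM tu)[]] := gJ_hermitian. Qed.

(** Being multiplicative, [F] serves both as the isometry and as the accompanying group
    automorphism. *)
Lemma transport_isomorphic : homogeneous_isomorphic g J lo lo_J.
Proof.
exists F, F; split.
- exact: la_diffeomorphism Ga FK GK.
- exact: la_lie_group Ga FK GK.
- by move=> a p _ _; exact: la_mul.
- by move=> p u v pM tu tv; rewrite !la_dM // transport_metric.
- move=> p u pM tu; rewrite !la_dM //; first exact: transport_acs.
  exact: acs_tangent.
Qed.

(** The Ledger-Obata symmetry at F m, conjugated by [F], whose inverse is [G]. *)
Let theta m p := G (lo_symmetry (F m) (F p)).

Lemma la_tangent_left (H : quat2 R -> quat2 R) p u : linear_automorphism H ->
  S3xS3 p -> tangent p u -> tangent (H p) (H u).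
Proof.
move=> Ha pM /(left_decomposition pM)[xi tx ->]; rewrite (la_mul Ha).
by apply: tangent_left; [exact: la_S3 | exact: la_tangent].
Qed.

Let dM_theta m p u : S3xS3 m -> S3xS3 p -> tangent p u ->
  dM (theta m) p u = G (dM (lo_symmetry (F m)) (F p) (F u)).
Proof.
move=> mM pM tu.
have d := is_diff_comp (is_diff_comp (la_is_diff Fa p)
  (is_diff_lo_symmetry (F m) (F p))) (la_is_diff Ga _).
rewrite (dM_is_diff pM tu d) /=; congr G.
by rewrite (dM_is_diff (la_S3 Fa pM) (la_tangent_left Fa pM tu)
  (is_diff_lo_symmetry _ _)).
Qed.

Let thetaS3 m p : S3xS3 m -> S3xS3 p -> S3xS3 (theta m p).
Proof.
by move=> mM pM; apply: (la_S3 Ga); apply: S3xS3_lo_symmetry; exact: la_S3.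
Qed.

Let theta3 m p : S3xS3 m -> S3xS3 p -> theta m (theta m (theta m p)) = p.
Proof. by move=> mM pM; rewrite /theta !GK lo_symmetry3 ?FK //;
  exact: la_S3. Qed.

Let smooth_theta m (V : normedModType R) (f : V -> quat2 R) :
  smooth f -> smooth (fun x => theta m (f x)).
Proof.
by move=> sf; apply: (la_smooth Ga); apply: smooth_lo_symmetry;
  exact: (la_smooth Fa).
Qed.

Lemma transport_three_symmetric : three_symmetric g J.
Proof.
exists theta => m mM; have FmM := la_S3 Fa mM.
have sth : smooth (theta m) by apply: smooth_theta; exact: smooth_id.
split.
- split.
    split; [by exists (theta m) | by move=> p pM; exact: thetaS3 |].
    (* A map of order three has its square as inverse. *)
    exists (fun p => theta m (theta m p)); split.
    + by exists (fun p => theta m (theta m p)); split=> //; exact: smooth_theta.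
    + by move=> p pM; do !apply: thetaS3.
    + by move=> p pM; rewrite theta3.
  move=> p u v pM tu tv; rewrite !dM_theta // -[RHS]transport_metric //.
  have FpM := la_S3 Fa pM.
  have [xi tx Fu] := left_decomposition FpM (la_tangent_left Fa pM tu).
  have [eta te Fv] := left_decomposition FpM (la_tangent_left Fa pM tv).
  rewrite Fu Fv -(lo_symmetry_isometry s FmM FpM tx te).
  have tG zeta : tangent base zeta ->
      tangent (theta m p) (G (dM (lo_symmetry (F m)) (F p) (mul2 (F p) zeta))).
    move=> tz; apply: (la_tangent_left Ga); first exact: S3xS3_lo_symmetry.
    exact: tangent_dM_lo_symmetry.
  rewrite -(transport_metric (thetaS3 mM pM) (tG _ tx) (tG _ te)).
  have -> : F (theta m p) = lo_symmetry (F m) (F p) by exact: GK.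
  by move: (dM _ _ (mul2 _ xi)) (dM _ _ (mul2 _ eta)) => a b;
    rewrite (GK a) (GK b).
- by rewrite /theta lo_symmetry_fixed // FK.
(* This real part is 1 at m, hence positive nearby, which excludes the fixed points of [lo_theta]
   with real part -1/2. *)
- pose f p : R := qc (F (mul2 (inv2 m) p)).1 0.
  have fc : {for m, continuous f}.
    apply: differentiable_continuous; apply: smooth_diff.
    have s1 : smooth (fun p => (F (mul2 (inv2 m) p)).1).
      apply: smooth_fst; apply: (la_smooth Fa); apply: smooth_mul2.
        exact: smooth_cst.
      exact: smooth_id.
    have -> : f = fun p => qdot q1 (F (mul2 (inv2 m) p)).1.
      by apply/funext => p; rewrite /f /q1; move: (F _).1 => x; rewrite !qE;
        ring.
    by apply: smooth_qdot => //; exact: smooth_cst.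
  have fm : f m = 1 by rewrite /f mulV2 // (la_base Fa) /base /q1 /= qmkE.
  have f0 : 0 < f m by rewrite fm ltr01.
  have := @cvgr_gt _ _ (nbhs m) (nbhs_filter m) f (f m) fc 0 f0.
  apply: filterS => p fp pM tp.
  have FpM := la_S3 Fa pM.
  have qM : S3xS3 (mul2 (inv2 m) p) by apply: S3xS3_mul => //; exact: S3xS3_inv.
  have E : F (mul2 (inv2 m) p) = base.
    apply: lo_theta_isolated => //; first exact: la_S3.
    have : lo_symmetry (F m) (F p) = F p by rewrite -[LHS]GK -/(theta m p) tp.
    move=> /(congr1 (mul2 (inv2 (F m)))); rewrite /lo_symmetry mul2_left_inv //.
    by rewrite (la_mul Fa) (la_inv Fa).
  rewrite -[LHS](mul2_inv_left _ mM) -[mul2 (inv2 m) p]FK E.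
  by rewrite (la_base Ga) mul2_base.
- by move=> p pM; exact: theta3.
- move=> u tu; rewrite dM_theta //.
  have -> : dM (lo_symmetry (F m)) (F m) (F u) = F (- 2^-1 *: u + (Num.sqrt 3 /
    2) *: J m u).
    rewrite (la_linear Fa) (la_scale Fa) transport_acs // /lo_J scalerA.
    have -> : Num.sqrt 3 / 2 * (2 / Num.sqrt 3) = 1 :> R.
      by field; rewrite gt_eqF // sqrtr_gt0.
    by rewrite scale1r addrCA -scalerDl addNr scale0r addr0.
  by rewrite FK.
Qed.
End Transport.
End LinearAutomorphism.

Section StandardAutomorphisms.
Context {R : realType}.
Implicit Types (p q xi : quat2 R) (U : 'M[R]_3).

Definition swap p : quat2 R := (p.2, p.1).
Definition rot_left U p : quat2 R := (rot U p.1, p.2).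

Lemma swap_automorphism : linear_automorphism swap.
Proof.
split => //.
- by move=> V f sf; apply: smooth_pair; [exact: smooth_snd | exact: smooth_fst].
- by move=> p [].
- by move=> xi [].
Qed.

Lemma rot_left_automorphism U : U *m U^T = 1%:M -> \det U = 1 ->
  linear_automorphism (rot_left U).
Proof.
move=> UU dU; split.
- by move=> c u v; rewrite /rot_left /= rot_is_linear.
- move=> V f sf; apply: smooth_pair; last exact: smooth_snd.
  apply: (@smooth_lin _ _ _ _ (rot U)); first exact: linear_rV_continuous.
  exact: smooth_fst.
- by move=> p q; rewrite /rot_left /mul2 /= rot_mul.
- by move=> p [p1 p2]; split=> //; rewrite /S3 /= qdot_rot.
- by rewrite /rot_left /= rot_q1.
- move=> xi [t1 t2]; split=> //; rewrite /tangent_S3 /=.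
  by rewrite -(rot_q1 U) qdot_rot.
Qed.

Lemma comp_automorphism (F H : quat2 R -> quat2 R) :
  linear_automorphism F -> linear_automorphism H -> linear_automorphism (F \o
    H).
Proof.
move=> Fa Ha; split.
- by move=> c u v /=; rewrite (la_linear Ha) (la_linear Fa).
- by move=> V f sf; apply: (la_smooth Fa); exact: (la_smooth Ha).
- by move=> p q /=; rewrite (la_mul Ha) (la_mul Fa).
- by move=> p pM /=; apply: (la_S3 Fa); exact: (la_S3 Ha).
- by rewrite /= (la_base Ha) (la_base Fa).
- by move=> xi t /=; apply: (la_tangent Fa); exact: (la_tangent Ha).
Qed.

Lemma rot_leftK U : U *m U^T = 1%:M -> cancel (rot_left U) (rot_left U^T).
Proof. by move=> UU [a b]; rewrite /rot_left /= rotK. Qed.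

Lemma qdot_imq x y : qdot (imq x : quat R) (imq y) = dot x y.
Proof. by rewrite qdotE /imq !qE /dot; ring. Qed.

Lemma rot_left_frame U (X : 'rV[R]_(3 + 3)) :
  rot_left U (frame X) = (imq (lsubmx X *m U), imq (rsubmx X)).
Proof. by rewrite /rot_left /= rot_imq. Qed.

Lemma lo_gram_form s U (X Y : 'rV[R]_(3 + 3)) : U *m U^T = 1%:M ->
  form (lo_gram s U) X Y = lo_form s (rot_left U (frame X)) (rot_left U (frame
    Y)).
Proof.
move=> UU; rewrite -[X]hsubmxK -[Y]hsubmxK form_row_mx !rot_left_frame.
rewrite !row_mxKl !row_mxKr /lo_form /= !qdot_imq dot_orthogonal //.
move: (lsubmx X) (rsubmx X) (lsubmx Y) (rsubmx Y) => x y x' y'.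
rewrite /lo_gram -scalemxAr mul_row_block !mulmx1 scale_row_mx row_mxKl
  row_mxKr.
rewrite -!scalemxAr !dotZl !dotDl !dotZl.
have -> : dot (y *m U^T) x' = dot y (x' *m U) by rewrite dot_mulmx trmxK.
ring.
Qed.

Lemma lo_form_swap s xi eta : lo_form s (swap xi) (swap eta) = lo_form s xi eta
  :> R.
Proof. by rewrite /lo_form /swap /=; ring. Qed.

Lemma rot_left_acs e U (X : 'rV[R]_(3 + 3)) : U *m U^T = 1%:M ->
  let xi := rot_left U (frame X) in
  rot_left U (frame (X *m lo_acs e U)) =
  (e / Num.sqrt 3) *: (xi.1 - 2 *: xi.2, 2 *: xi.1 - xi.2).
Proof.
move=> UU /=; have VU := mulmx1C UU; rewrite !rot_left_frame /= -[X]hsubmxK.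
rewrite !row_mxKl !row_mxKr.
move: (lsubmx X) (rsubmx X) => x y.
rewrite /lo_acs -scalemxAr mul_row_block mulmx1 scale_row_mx row_mxKl row_mxKr.
rewrite rot_imq mulmxN mulmx1 -!scalemxAr -scalemxAl mulmxDl -scalemxAl -mulmxA
  VU mulmx1.
move: (x *m U) => z; congr pair.
  by apply: quatP; rewrite /imq !qE ?mxE; ring.
by apply: quatP; rewrite /imq !qE ?mxE; ring.
Qed.

End StandardAutomorphisms.

Theorem proposition3p1 (R : realType)
    (g : quat2 R -> quat2 R -> quat2 R -> R)
    (J : quat2 R -> quat2 R -> quat2 R)
    (nabla : (quat2 R -> quat2 R) -> (quat2 R -> quat2 R) -> quat2 R -> quat2 R)
    (gJ_hermitian : almost_hermitian g J)
    (gJ_invariant : left_invariant g J)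
    (nabla_LC : levi_civita g nabla)
    (J_SNK : strictly_nearly_kahler nabla J) :
  (exists b : quat R -> quat R -> quat R -> R,
     biinvariant_metric b /\
     homogeneous_isomorphic g J (lo_metric b) lo_J)
  /\ three_symmetric g J.
Proof.
have [nk _] := J_SNK.
have [s [e [U [s0 e1 UU dU [gE JE]]]]] :=
  frame_classification gJ_hermitian gJ_invariant nabla_LC nk.
have VU := mulmx1C UU.
suff [F [G [Fa Ga FK GK [gF JF]]]] : exists F G : quat2 R -> quat2 R,
    [/\ linear_automorphism F, linear_automorphism G, cancel F G, cancel G F &
     (forall xi eta, tangent base xi -> tangent base eta ->
        g base xi eta = lo_form s (F xi) (F eta)) /\
     (forall xi, tangent base xi -> F (J base xi) =
        (Num.sqrt 3)^-1 *: ((F xi).1 - 2 *: (F xi).2,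
          2 *: (F xi).1 - (F xi).2))].
  split; last exact: (transport_three_symmetric gJ_hermitian gJ_invariant Fa Ga
    FK GK gF JF).
  (* The factor 3/2 compensates the 2/3 produced by projecting to the complement X + Y + Z = 0. *)
  exists (scaled_metric (3 / 2 * s)); split.
    by apply: scaled_biinvariant; rewrite mulr_gt0 // divr_gt0.
  exact: (transport_isomorphic gJ_hermitian gJ_invariant Fa Ga FK GK gF JF).
have Fa := rot_left_automorphism UU dU.
have Ga : linear_automorphism (rot_left U^T).
  by apply: rot_left_automorphism; rewrite ?trmxK ?det_tr.
have FK := rot_leftK UU.
have GK : cancel (rot_left U^T) (rot_left U).
  by rewrite -{2}[U]trmxK; apply: rot_leftK; rewrite trmxK.
have gF xi eta : tangent base xi -> tangent base eta ->
    g base xi eta = lo_form s (rot_left U xi) (rot_left U eta).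
  by move=> tx te; rewrite -(coframeK tx) -(coframeK te) gE lo_gram_form.
have JF xi : tangent base xi -> rot_left U (J base xi) = let zeta := rot_left U
  xi in
   (e / Num.sqrt 3) *: (zeta.1 - 2 *: zeta.2, 2 *: zeta.1 - zeta.2).
  by move=> tx; rewrite -(coframeK tx) JE rot_left_acs.
have sa := @swap_automorphism R.
have swapK (p : quat2 R) : swap (swap p) = p by case: p.
case: e1 => e1; rewrite e1 in JF.
  exists (rot_left U), (rot_left U^T); split=> //; split=> // xi tx.
  by rewrite JF // mul1r.
(* For e = -1: swapping the components of (x - 2 y, 2 x - y) gives minus the same expression in (y,
   x), so the exchange of factors turns - J into J and leaves the metric unchanged. *)
exists (swap \o rot_left U), (rot_left U^T \o swap); split.
- exact: comp_automorphism.
- exact: comp_automorphism.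
- by move=> p /=; rewrite swapK FK.
- by move=> p /=; rewrite GK swapK.
split=> [xi eta tx te|xi tx]; first by rewrite gF // -lo_form_swap.
rewrite /= JF //= mulN1r; move: (rot_left U xi) => z.
by rewrite /swap /=; congr pair; rewrite scaleNr -scalerN opprB.
Qed.
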